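(* Let $\Sigma\subseteq\mathcal F$ be a $\sigma$-ideal and $g\in L^0(\Sigma)$. Let $X_g=\{\mu\in\mathcal M:|\mu|(A)=0\ \forall A\in\Sigma,\ \int|g|\,d|\mu|<\infty\}$, $X_g^1=X_g\cap\mathcal M^1$, and $\Xi=\{A\in\mathcal F:\forall\mu\in X_g,\ |\mu|(A)=0\}$. Then for every $\nu\in X_g^1$, the function $\varepsilon\mapsto\inf\{D_\varphi(\mu\|\nu):\mu\in X_g^1,\ |\int g\,d\mu-\int g\,d\nu|=\varepsilon\}$ on $[0,\infty)$ (with $\inf\emptyset=+\infty$) is not identically zero if and only if $0$ is in the interior of $\operatorname{dom}K_{g,\nu,\Xi}=\{t\in\mathbb R:K_{g,\nu,\Xi}(t)<+\infty\}$. In other words, the following are equivalent: (i) there exists a function $L:[0,\infty)\to[0,+\infty]$, not identically zero, such that $D_\varphi(\mu\|\nu)\ge L\big(|\int g\,d\mu-\int g\,d\nu|\big)$ for every $\mu\in X_g^1$; (ii) the function $K_{g,\nu,\Xi}$ is finite on an open interval around $0$.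
   Context: $(\Omega,\mathcal F)$ is a measurable space with $\{\emptyset,\Omega\}\subsetneq\mathcal F$; $\mathcal M,\mathcal M^+,\mathcal M^1$ are the sets of finite signed measures, finite non-negative measures and probability measures on it. For a $\sigma$-ideal $\Xi\subseteq\mathcal F$, $L^0(\Xi)$ is the space of real measurable functions modulo equality outside an element of $\Xi$; $\operatorname{ess\,im}_\Xi f=\bigcap_{\epsilon>0}\{x\in\mathbb R: f^{-1}((x-\epsilon,x+\epsilon))\notin\Xi\}$ and $\operatorname{ess\,sup}_\Xi f=\sup\operatorname{ess\,im}_\Xi f$. Standing assumptions on $\varphi$: $\varphi:\mathbb R\to[0,+\infty]$ is convex, lower semicontinuous, $\varphi(1)=0$, $\varphi(x)=+\infty$ for $x<0$, and $\operatorname{dom}\varphi$ contains a neighborhood of $1$. $\varphi'(\pm\infty)=\lim_{x\to\pm\infty}\varphi(x)/x$. Set $\psi(x)=\varphi(x+1)$; $f^\star(y)=\sup_x\{xy-f(x)\}$ denotes the convex conjugate. For $\mu\in\mathcal M$, $\nu\in\mathcal M^+$ with Lebesgue decomposition $\mu=\mu_c+\mu_s$ ($\mu_c\ll\nu$, $\mu_s\perp\nu$) and Hahn–Jordan decomposition $\mu_s=\mu_s^+-\mu_s^-$, $D_\varphi(\mu\|\nu)=\int\varphi(\frac{d\mu_c}{d\nu})d\nu+\mu_s^+(\Omega)\varphi'(\infty)-\mu_s^-(\Omega)\varphi'(-\infty)$, with $0\cdot(\pm\infty)=0$. Cumulant generating function: for $\nu\in\mathcal M^1$ vanishing on $\Xi$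 and $g\in L^0(\Xi)$, $$K_{g,\nu,\Xi}(t)=\inf\Big\{\int\psi^\star(tg+\lambda)\,d\nu:\lambda\in\mathbb R,\ \lambda+\operatorname{ess\,sup}_\Xi(tg)\le\varphi'(\infty)\Big\},\quad t\in\mathbb R.$$ *)

(* Defs.v *)
From HB Require Import structures.
From mathcomp Require Import all_boot all_order all_algebra.
From mathcomp Require Import all_classical all_reals all_analysis.

Set Implicit Arguments.
Unset Strict Implicit.
Unset Printing Implicit Defensive.

Import Order.TTheory GRing.Theory Num.Theory.
Import numFieldNormedType.Exports.

Local Open Scope classical_set_scope.
Local Open Scope ring_scope.
Local Open Scope ereal_scope.
Local Open Scope charge_scope.

Section convex_analysis.
Context {R : realType}.
Implicit Type f : R -> \bar R.

(* The library's convex_function only covers real-valued functions.  For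
   f > -oo the right-hand side is never of the form oo - oo. *)
Definition econvex f := forall (x y t : R), (0 <= t <= 1)%R ->
  f (t * x + (1 - t) * y)%R <= t%:E * f x + (1 - t)%:E * f y.

Definition fenchel_conjugate f (y : R) : \bar R :=
  ereal_sup [set (x * y)%:E - f x | x in [set: R]].

Definition slope_pinfty f : \bar R := lim ((f x * (x^-1)%:E) @[x --> +oo%R]).

Definition slope_ninfty f : \bar R := lim ((f x * (x^-1)%:E) @[x --> -oo%R]).

End convex_analysis.

Section sigma_ideal.
Context d (T : measurableType d) {R : realType}.
Implicit Type Xi : set (set T).

Definition sigma_ideal Xi :=
  [/\ Xi `<=` measurable,
      Xi set0,
      (forall A B, measurable A -> A `<=` B -> Xi B -> Xi A)
    & (forall F : (set T)^nat, (forall n, Xi (F n)) -> Xi (\bigcup_n F n))].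

(* Elements of L^0(Xi) are given by measurable representatives; ideal_ess_im is
   invariant under modification on a set of Xi. *)
Definition ideal_ess_im Xi (f : T -> R) : set R :=
  \bigcap_(e in [set e : R | (0 < e)%R])
    [set x | ~ Xi (f @^-1` `](x - e)%R, (x + e)%R[%classic)].

Definition ideal_ess_sup Xi (f : T -> R) : \bar R :=
  ereal_sup [set x%:E | x in ideal_ess_im Xi f].

End sigma_ideal.

Section total_variation.
Context d (T : measurableType d) {R : realType}.
Variable mu : {charge set T -> \bar R}.

(* By Hahn_decomposition_uniq, the values on measurable sets do not depend on
   the chosen Hahn decomposition. *)
Let P : set T := sval (cid (Hahn_decomposition mu)).
Let N : set T := sval (cid (svalP (cid (Hahn_decomposition mu)))).

Lemma Hahn_choice : hahn_decomposition mu P N.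
Proof. exact: svalP (cid (svalP (cid (Hahn_decomposition mu)))). Qed.

Definition pos_part : {finite_measure set T -> \bar R} :=
  jordan_pos Hahn_choice.

Definition neg_part : {finite_measure set T -> \bar R} :=
  jordan_neg Hahn_choice.

Definition total_variation : {measure set T -> \bar R} :=
  charge_variation Hahn_choice.

End total_variation.

Section lebesgue_decomposition.
Context d (T : measurableType d) {R : realType}.
Implicit Types (mu : {charge set T -> \bar R})
  (nu : {finite_measure set T -> \bar R}).

Definition mutually_singular (m1 m2 : set T -> \bar R) := exists N : set T,
  [/\ measurable N, m2.-null_set N & m1.-null_set (~` N)].

Definition lebesgue_decomposition mu nu
    (muc mus : {charge set T -> \bar R}) :=
  [/\ muc `<< nu,
      mutually_singular mus nu
    & forall A, measurable A -> mu A = muc A + mus A].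

Lemma lebesgue_decomposition_ex mu nu :
  exists mucs : {charge set T -> \bar R} * {charge set T -> \bar R},
    lebesgue_decomposition mu nu mucs.1 mucs.2.
Proof.
pose m := total_variation mu.
have mfin A : measurable A -> m A \is a fin_num.
  by move=> mA; rewrite /m /= /total_variation fin_num_measure.
pose S := [set m N | N in [set N | measurable N /\ nu N = 0]].
pose s := ereal_sup S.
have Ss N : measurable N -> nu N = 0 -> m N <= s.
  by move=> mN N0; apply: ereal_sup_ubound; exists N.
have s0 : 0 <= s by rewrite -(measure0 m); apply: Ss.
have sfin : s \is a fin_num.
  rewrite ge0_fin_numE//; apply: (@le_lt_trans _ _ (m setT)).
    apply: ge_ereal_sup => _ [N [mN _] <-].
    by apply: le_measure => //; rewrite inE.
  by rewrite -ge0_fin_numE//; exact: mfin.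
have /choice[F FP] (n : nat) : exists N : set T,
    [/\ measurable N, nu N = 0 & s - (n.+1%:R^-1)%:E < m N].
  have n0 : (0 < n.+1%:R^-1 :> R)%R by rewrite invr_gt0.
  have [_ [N [mN N0] <-] ?] := ub_ereal_sup_adherent n0 sfin.
  by exists N; split.
pose N := \bigcup_n F n.
have mN : measurable N by apply: bigcup_measurable => n _; have [] := FP n.
have N0 : nu N = 0.
  apply/negligibleP => //; apply: negligible_bigcup => n.
  by have [mF F0 _] := FP n; exists (F n); split.
have sN : s <= m N.
  apply/lee_addgt0Pr => e e0.
  have [n _ /(_ n (leqnn n)) /= ne] := near_infty_natSinv_lt (PosNum e0).
  have [mF _ /ltW sF] := FP n.
  rewrite -leeBlDr//; apply: (le_trans _ (le_trans sF _)).
    by rewrite leeB// lee_fin ltW.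
  by apply: le_measure; rewrite ?inE//; exact: bigcup_sup.
have AN0 A : measurable A -> nu A = 0 -> m (A `&` ~` N) = 0.
  move=> mA A0.
  have mAN : measurable (A `&` ~` N).
    by apply: measurableI => //; exact: measurableC.
  apply/eqP; rewrite eq_le measure_ge0 andbT.
  have dAN : N `&` (A `&` ~` N) = set0 by rewrite setICA setICr setI0.
  have mU : measurable (N `|` (A `&` ~` N)) by exact: measurableU.
  have nuU : nu (N `|` (A `&` ~` N)) = 0.
    rewrite measureU//= N0 add0e; apply/eqP.
    by rewrite eq_le measure_ge0 andbT -A0 le_measure ?inE//; exact: subIsetl.
  have : m (N `|` (A `&` ~` N)) <= m N by exact: le_trans (Ss _ mU nuU) sN.
  rewrite measureU//=; rewrite -[X in _ <= X](adde0 (m N)).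
  by rewrite leeD2lE// mfin.
exists (crestr0 mu (measurableC mN) : {charge set T -> \bar R},
        crestr0 mu mN : {charge set T -> \bar R}) => /=; split.
- apply/null_content_dominatesP => A mA A0.
  rewrite /= /crestr0 mem_set// /crestr.
  apply/eqP; rewrite -abse_eq0 eq_le abse_ge0 andbT -(AN0 A mA A0).
  apply: abse_charge_variation.
  by apply: measurableI => //; exact: measurableC.
- exists N; split => //; first exact/measure0_null_setP.
  move=> A mA AN; rewrite /= /crestr0 mem_set// /crestr.
  by rewrite (_ : A `&` N = set0) ?charge0//; apply/disjoints_subset.
- move=> A mA; rewrite /= /crestr0 !mem_set// /crestr.
  apply: charge_partition => //; first exact: measurableC.
    by rewrite setUC setUCr.
  by rewrite setIC setICr.
Qed.

Definition ac_part mu nu : {charge set T -> \bar R} :=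
  (sval (cid (lebesgue_decomposition_ex mu nu))).1.

Definition sing_part mu nu : {charge set T -> \bar R} :=
  (sval (cid (lebesgue_decomposition_ex mu nu))).2.

Lemma lebesgue_decompositionP mu nu :
  lebesgue_decomposition mu nu (ac_part mu nu) (sing_part mu nu).
Proof. exact: svalP (cid (lebesgue_decomposition_ex mu nu)). Qed.

(* [fine] is harmless: the Radon-Nikodym derivative of an absolutely continuous
   charge is everywhere finite. *)
Definition divergence (phi : R -> \bar R) mu nu : \bar R :=
  \int[nu]_x phi (fine (('d (ac_part mu nu) '/d nu) x))
  + pos_part (sing_part mu nu) [set: T] * slope_pinfty phi
  - neg_part (sing_part mu nu) [set: T] * slope_ninfty phi.

End lebesgue_decomposition.

Section cumulant.
Context d (T : measurableType d) {R : realType}.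

(* When phi 1 = 0, fenchel_conjugate psi is nonnegative, so that the integral is
   well defined. *)
Definition cumulant (phi : R -> \bar R) (g : T -> R)
    (nu : probability T R) (Xi : set (set T)) (t : R) : \bar R :=
  let psi x := phi (x + 1)%R in
  ereal_inf [set \int[nu]_x fenchel_conjugate psi (t * g x + l)%R
            | l in [set l : R |
                l%:E + ideal_ess_sup Xi (fun x => t * g x)%R <= slope_pinfty phi]].

End cumulant.

Section spaces.
Context d (T : measurableType d) {R : realType}.
Variables (Sigma : set (set T)) (g : T -> R).

Definition Xg : set ({charge set T -> \bar R}) :=
  [set mu | (forall A, Sigma A -> total_variation mu A = 0) /\
            \int[total_variation mu]_x `|(g x)%:E| < +oo].

(* Probability measures are kept in their library type, so that the library
   integral applies to them. *)
Definition Xg1 : set (probability T R) :=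
  [set mu | Xg (charge_of_finite_measure mu)].

Definition null_ideal : set (set T) :=
  [set A | measurable A /\ forall mu, Xg mu -> total_variation mu A = 0].

Definition mean_gap (mu nu : probability T R) : R :=
  `| \int[mu]_x g x - \int[nu]_x g x |%R.

Definition optimal_lower_bound (phi : R -> \bar R) (nu : probability T R)
    (e : R) : \bar R :=
  ereal_inf [set divergence phi (charge_of_finite_measure mu) nu
            | mu in [set mu | Xg1 mu /\ mean_gap mu nu = e]].

End spaces.

(* Main.v *)
From HB Require Import structures.
Require Import Defs.
From mathcomp Require Import all_boot all_order all_algebra.
From mathcomp Require Import all_classical all_reals all_analysis.
From mathcomp Require Import measurable_realfun ring lra.

Set Implicit Arguments.
Unset Strict Implicit.
Unset Printing Implicit Defensive.

Import Order.TTheory GRing.Theory Num.Theory.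
Import numFieldNormedType.Exports.

Local Open Scope classical_set_scope.
Local Open Scope ring_scope.
Local Open Scope ereal_scope.

(* Write gap = mu(g) - nu(g).

   If K(t) and K(-t) are finite, the Fenchel-Young inequality for psi and psi^*
   at t g + l on the part of mu that is absolutely continuous with respect to
   nu, together with t g + l <= phi'(oo) on the singular part, gives
   t gap <= D + K(t) and - t gap <= D + K(-t), so that D is bounded away from 0
   when |gap| is large.

   Conversely let D >= c > 0 whenever gap = e > 0; it is enough to bound K(t)
   for t >= 0 with t e < c / 2, as t <= 0 follows by replacing g by - g.
   - If g <= N outside of an element of Xi, then l = - t N works, because
     psi^*(y) <= |y| for y <= 0.
   - If g is unbounded modulo Xi and phi'(oo) < oo, moving a small mass eta of
     nu to a measure of X_g that lives on {g > N} realizes gap = e at a cost of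
     at most phi(1 - eta) + phi'(oo) eta, which is less than c: contradiction.
   - If phi'(oo) = oo, put G = g - nu(g) and let h_n be the largest h <= n with
     psi(h) <= t h G on {G > M}, and 0 elsewhere.  If int h_n G dnu >= e for some
     n, adding a multiple of h_n to the density 1 - eta realizes gap = e at a
     cost of at most phi(1 - eta) + t e < c: contradiction.  Otherwise
     psi^*(t G) <= sup_n t h_n G on {G > M}, whose integral is at most t e by
     monotone convergence, and psi^*(t G) <= C t |G| elsewhere. *)

(** * Charges, densities and mixtures *)

(** On the negative set of a Hahn decomposition [c] is both nonnegative and nonpositive, so the
    negative part vanishes. *)
Lemma jordan_parts_ge0 d (T : measurableType d) (R : realType)
    (c : {charge set T -> \bar R}) :
  (forall A, measurable A -> 0 <= c A) ->
  forall A, measurable A -> pos_part c A = c A /\ neg_part c A = 0.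
Proof.
move=> c0 A mA.
have n0 : neg_part c A = 0.
  rewrite /neg_part /= jordan_negE cjordan_negE /crestr0 mem_set// /crestr.
  have [_ [mN negN] _ _] := Hahn_choice c.
  set N := sval _ in mN negN *.
  have mAN : measurable (A `&` N) by exact: measurableI.
  have -> : c (A `&` N) = 0; last by rewrite oppe0.
  apply/eqP; rewrite eq_le c0// andbT.
  by apply: negN => //; exact: subIsetr.
split=> //.
rewrite [RHS](jordan_decomp (Hahn_choice c) mA)/= /cadd/= cscaleN1/=.
by move: n0; rewrite /neg_part/= => ->; rewrite oppe0 adde0.
Qed.

Lemma total_variation_finite_measure d (T : measurableType d) (R : realType)
    (mu : {finite_measure set T -> \bar R}) (A : set T) : measurable A ->
  Defs.total_variation (charge_of_finite_measure mu) A = mu A.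
Proof.
move=> mA; have [|p n0] := @jordan_parts_ge0 _ _ _ (charge_of_finite_measure mu) _ A mA.
  by move=> B mB; exact: measure_ge0.
move: p n0; rewrite /pos_part /neg_part /= => + n0.
by rewrite /Defs.total_variation/= /charge_variation n0 adde0.
Qed.

Lemma Xg1P d (T : measurableType d) (R : realType) (Sigma : set (set T))
    (g : T -> R) (mu : probability T R) : Sigma `<=` measurable ->
  Xg1 Sigma g mu <->
  (forall A, Sigma A -> mu A = 0) /\ \int[mu]_x `|(g x)%:E| < +oo.
Proof.
move=> mS; have mE := @total_variation_finite_measure _ T R mu.
have iE : \int[Defs.total_variation (charge_of_finite_measure mu)]_x `|(g x)%:E| =
    \int[mu]_x `|(g x)%:E|.
  by apply: eq_measure_integral => A mA _; exact: mE.
by split=> -[S0 gfin]; (split; last by rewrite iE in gfin * || rewrite -iE);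
  move=> A SA; have := S0 _ SA; rewrite mE//; exact: mS.
Qed.

(** Here [eta] is the weight kept by [nu]; in [mixture_Xg1] it is the mass taken away. *)
Lemma mixture_ex d (T : measurableType d) (R : realType)
    (nu : probability T R) (rho : {measure set T -> \bar R}) (eta : {nonneg R}) :
  (eta%:num <= 1)%R -> rho [set: T] = (1 - eta%:num)%:E ->
  exists mu : probability T R,
    mu = measure_add (mscale eta nu) rho :> (set T -> \bar R).
Proof.
move=> eta1 rhoT; pose m : {measure set T -> \bar R} := measure_add (mscale eta nu) rho.
have mT : m [set: T] = 1.
  have -> : m [set: T] = eta%:num%:E * nu [set: T] + rho [set: T].
    exact: measure_addE.
  by rewrite probability_setT mule1 rhoT -EFinD addrCA subrr addr0.
pose P := HB.pack_for (probability T R) (Measure.sort m)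
  (Measure_isProbability.Build _ _ _ m mT).
by exists P.
Qed.

(** [f] and the Radon-Nikodym derivative of [rho] have the same integral over every measurable set,
    so they agree almost everywhere, and the change of variables passes from one to the other. *)
Lemma density_integral d (T : measurableType d) (R : realType)
    (nu : probability T R) (rho : {finite_measure set T -> \bar R})
    (f : T -> R) : measurable_fun [set: T] f -> (forall x, 0 <= f x)%R ->
  (forall A, measurable A -> rho A = \int[nu]_(x in A) (f x)%:E) ->
  forall u : T -> \bar R, measurable_fun [set: T] u -> (forall x, 0 <= u x) ->
  \int[rho]_x u x = \int[nu]_x (u x * (f x)%:E).
Proof.
move=> mf f0 fE u mu u0.
have rhonu : rho `<< nu.
  apply/null_content_dominatesP => A mA A0; rewrite fE//.
  by apply: null_set_integral => //; apply/measurable_funTS/measurable_EFinP.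
rewrite -(Radon_Nikodym_SigmaFinite.change_of_variables rhonu)//.
have mh : measurable_fun [set: T] (Radon_Nikodym_SigmaFinite.f rho nu).
  exact: measurable_int (Radon_Nikodym_SigmaFinite.f_integrable rhonu).
apply: ae_eq_integral => //.
- exact: emeasurable_funM.
- by apply: emeasurable_funM => //; exact/measurable_EFinP.
- apply: ae_eqe_mul2l; apply: integral_ae_eq => //.
  + exact: Radon_Nikodym_SigmaFinite.f_integrable.
  + exact/measurable_EFinP.
  + by move=> A _ mA; rewrite -fE// -Radon_Nikodym_SigmaFinite.f_integral.
Qed.

(** This frees all later estimates from charges: [f] is the density of [mu] on a set [N] of full
    [nu]-measure. The singular part of a probability measure is nonnegative, so the slope at -oo
    drops out. *)
Lemma divergence_probability d (T : measurableType d) (R : realType)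
    (phi : R -> \bar R) (nu mu : probability T R) :
  (forall x, 0 <= phi x) -> measurable_fun [set: R] phi ->
  exists (N : set T) (f : T -> R),
    [/\ measurable N /\ nu (~` N) = 0,
        measurable_fun [set: T] f, (forall x, 0 <= f x)%R,
        (forall A, measurable A -> mu (A `&` N) = \int[nu]_(x in A) (f x)%:E)
      & divergence phi (charge_of_finite_measure mu) nu =
        \int[nu]_x phi (f x) + mu (~` N) * slope_pinfty phi].
Proof.
move=> phi0 mphi; have := lebesgue_decompositionP (charge_of_finite_measure mu) nu.
set muc := ac_part _ _; set mus := sing_part _ _.
move=> -[cnu [N [mN N0 sN]] muE].
have mNC : measurable (~` N) by exact: measurableC.
have split_N (c : {charge set T -> \bar R}) A : measurable A ->
    c A = c (A `&` N) + c (A `&` ~` N).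
  by move=> mA; apply: charge_partition => //; rewrite ?setUv ?setICr.
have cN0 A : measurable A -> muc (A `&` N) = 0.
  move=> mA; have mAN : measurable (A `&` N) by exact: measurableI.
  move/null_content_dominatesP : cnu; apply => //.
  by apply: N0 => //; exact: subIsetr.
have sNC0 A : measurable A -> mus (A `&` ~` N) = 0.
  move=> mA; apply: sN; last exact: subIsetr.
  exact: measurableI.
have cE A : measurable A -> muc A = mu (A `&` ~` N).
  move=> mA; rewrite split_N// cN0// add0e.
  have := muE _ (measurableI _ _ mA mNC); rewrite sNC0// adde0 => <-//.
have sE A : measurable A -> mus A = mu (A `&` N).
  move=> mA; rewrite split_N// sNC0// adde0.
  have := muE _ (measurableI _ _ mA mN); rewrite cN0// add0e => <-//.
have mus_ge0 A : measurable A -> 0 <= mus A.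
  by move=> mA; rewrite sE// measure_ge0.
have [pE nE] := jordan_parts_ge0 mus_ge0 measurableT.
(* The derivative of the charge [muc] is only almost everywhere nonnegative. The restricted measure
   has the same values and a derivative that is nonnegative everywhere. *)
pose rho : {finite_measure set T -> \bar R} := mrestr mu mNC.
have rhonu : rho `<< nu.
  by apply/null_content_dominatesP => A mA A0; rewrite /rho/= /mrestr -cE//;
    move/null_content_dominatesP : cnu; apply.
set f0 := Radon_Nikodym_SigmaFinite.f rho nu.
have f0fin := Radon_Nikodym_SigmaFinite.f_fin_num rhonu.
have f0i : nu.-integrable [set: T] f0 by exact: Radon_Nikodym_SigmaFinite.f_integrable.
have f0E A : measurable A -> mu (A `&` ~` N) = \int[nu]_(x in A) f0 x.
  by move=> mA; rewrite -Radon_Nikodym_SigmaFinite.f_integral.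
have mf0 : measurable_fun [set: T] (fine \o f0).
  by apply: measurableT_comp => //; exact: measurable_int f0i.
exists (~` N), (fine \o f0); rewrite setCK; split => //.
- by split => //; apply: N0.
- by move=> x; rewrite fine_ge0// Radon_Nikodym_SigmaFinite.f_ge0.
- by move=> A mA; rewrite f0E//; apply: eq_integral => x _; rewrite /= fineK.
rewrite /divergence -/muc -/mus pE nE mul0e sube0 sE// setTI; congr (_ + _).
have mD : measurable_fun [set: T] (Radon_Nikodym muc nu).
  exact: measurable_int (Radon_Nikodym_integrable cnu).
apply: ae_eq_integral => //.
- by apply: (measurableT_comp mphi); apply: measurableT_comp.
- exact: (measurableT_comp mphi).
have : ae_eq nu [set: T] (Radon_Nikodym muc nu) f0.
  apply: integral_ae_eq => //.
  - exact: Radon_Nikodym_integrable.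
  - exact: measurable_int f0i.
  - by move=> A _ mA; rewrite -Radon_Nikodym_integral// cE// f0E.
by apply: filterS => x /(_ I) /= ->.
Qed.

Lemma integral_mrestr_split d (T : measurableType d) (R : realType)
    (mu : {measure set T -> \bar R}) (N : set T) (mN : measurable N)
    (u : T -> \bar R) : mu.-integrable [set: T] u ->
  [/\ (mrestr mu mN).-integrable [set: T] u,
      (mrestr mu (measurableC mN)).-integrable [set: T] u
    & \int[mu]_x u x =
      \int[mrestr mu mN]_x u x + \int[mrestr mu (measurableC mN)]_x u x].
Proof.
move=> /integrableP[mu_u uoo].
pose rho : {measure set T -> \bar R} := mrestr mu mN.
pose sigma : {measure set T -> \bar R} := mrestr mu (measurableC mN).
have muE v : \int[mu]_x v x = \int[measure_add rho sigma]_x v x.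
  apply: eq_measure_integral => A mA _.
  transitivity (rho A + sigma A); last exact/esym/measure_addE.
  rewrite -[in LHS](setIT A) -(setUv N) setIUr measureU//.
  - exact: measurableI.
  - by apply: measurableI => //; exact: measurableC.
  - by rewrite setIACA setICr setI0.
have mau : measurable_fun [set: T] (fun x => `|u x|) by exact: measurableT_comp.
have := muE (fun x => `|u x|); rewrite ge0_integral_measure_add// => aE.
have ir : rho.-integrable [set: T] u.
  apply/integrableP; split => //; apply: le_lt_trans uoo.
  by rewrite aE leeDl// integral_ge0.
have is_ : sigma.-integrable [set: T] u.
  apply/integrableP; split => //; apply: le_lt_trans uoo.
  by rewrite aE leeDr// integral_ge0.
by split => //; rewrite muE integral_measure_add.
Qed.

Lemma integral_affine d (T : measurableType d) (R : realType)
    (P : probability T R) (g : T -> R) (t l : R) :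
  P.-integrable [set: T] (EFin \o g) ->
  P.-integrable [set: T] (fun x => (t * g x + l)%:E) /\
  \int[P]_x (t * g x + l)%:E = (t * (\int[P]_x g x)%R + l)%:E.
Proof.
move=> gi.
have tgi : P.-integrable [set: T] (fun x => t%:E * (g x)%:E).
  exact: integrableZl.
have li : P.-integrable [set: T] (cst l%:E).
  by apply: finite_measure_integrable_cst.
split.
  by have := integrableD measurableT tgi li; apply: eq_integrable.
rewrite (_ : (fun x => _) = (fun x => t%:E * (g x)%:E) \+ cst l%:E)//.
rewrite integralD// integralZl// integral_cst//.
rewrite [X in _ + _ * X](probability_setT P) mule1.
by rewrite EFinD EFinM /Rintegral fineK//; exact: integrable_fin_num.
Qed.

(** Signed version of [density_integral]: as [f] is nonnegative, the positive and negative parts of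
    [u * f] are those of [u] times [f]. *)
Lemma density_integrable d (T : measurableType d) (R : realType)
    (nu : probability T R) (rho : {finite_measure set T -> \bar R})
    (f : T -> R) : measurable_fun [set: T] f -> (forall x, 0 <= f x)%R ->
  (forall A, measurable A -> rho A = \int[nu]_(x in A) (f x)%:E) ->
  forall u : T -> R, measurable_fun [set: T] u ->
  rho.-integrable [set: T] (EFin \o u) ->
  nu.-integrable [set: T] (fun x => (u x * f x)%:E) /\
  \int[rho]_x (u x)%:E = \int[nu]_x (u x * f x)%:E.
Proof.
move=> mf f0 fE u mu ui.
have densE := density_integral mf f0 fE.
split.
  apply/integrableP; split.
    by apply/measurable_EFinP; exact: measurable_funM.
  case/integrableP : ui => _; rewrite densE//; last exact/measurableT_comp/measurable_EFinP.
  by under eq_integral do rewrite -EFinM -{1}(ger0_norm (f0 _)) -normrM.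
rewrite integralE [RHS]integralE !densE//; last 2 first.
- by apply: measurable_funeneg; exact/measurable_EFinP.
- by apply: measurable_funepos; exact/measurable_EFinP.
by congr (_ - _); apply: eq_integral => x _;
  rewrite ?funeposE ?funenegE/= -?EFinN -!EFin_max -EFinM maxr_pMl// mul0r ?mulNr.
Qed.

Lemma integral_mscale d (T : measurableType d) (R : realType)
    (m : {measure set T -> \bar R}) (k : {nonneg R}) (u : T -> \bar R) :
  m.-integrable [set: T] u ->
  (mscale k m).-integrable [set: T] u /\
  \int[mscale k m]_x u x = k%:num%:E * \int[m]_x u x.
Proof.
move=> mu_; have [mu uoo] := integrableP _ _ _ mu_.
split.
  apply/integrableP; split => //.
  rewrite ge0_integral_mscale//; last exact: measurableT_comp.
  by rewrite lte_mul_pinfty// lee_fin.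
rewrite (integralE (mscale k m)) (integralE m _ u).
have [mp mn] := (measurable_funepos mu, measurable_funeneg mu).
rewrite (ge0_integral_mscale _ _ _ mp)// (ge0_integral_mscale _ _ _ mn)//.
have pfin : \int[m]_x u^\+ x \is a fin_num.
  by apply: integrable_fin_num => //; exact: integrable_funepos.
by rewrite [RHS]muleBr// fin_num_adde_defr.
Qed.

Lemma density_measure_ex d (T : measurableType d) (R : realType)
    (nu : probability T R) (h : T -> R) :
  (forall x, 0 <= h x)%R -> nu.-integrable [set: T] (EFin \o h) ->
  exists rho : {finite_measure set T -> \bar R},
    forall A, rho A = \int[nu]_(x in A) (h x)%:E.
Proof.
move=> h0 hi; pose c : {charge set T -> \bar R} := induced_charge hi.
have c0 A : 0 <= c A by apply: integral_ge0 => x _; rewrite lee_fin.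
pose m : {measure set T -> \bar R} := measure_of_charge c c0.
have mfin : fin_num_fun m by move=> A mA; exact: (fin_num_measure c).
pose P := HB.pack_for {finite_measure set T -> \bar R} (Measure.sort m)
  (Measure_isFinite.Build _ _ _ m mfin).
by exists P.
Qed.

Lemma Xg1_integrable d (T : measurableType d) (R : realType)
    (Sigma : set (set T)) (g : {mfun T >-> R}) (mu : probability T R) :
  Sigma `<=` measurable -> Xg1 Sigma g mu ->
  mu.-integrable [set: T] (EFin \o g).
Proof.
move=> Sm /(Xg1P _ _ Sm)[_ goo]; apply/integrableP; split => //.
by apply/measurable_EFinP; exact: measurable_funP.
Qed.

(** Both constructions of measures with prescribed gap and small divergence are of this form: [nu]
    gives up the mass [eta], and [rho] puts it back where [g] is large. *)
Lemma mixture_Xg1 d (T : measurableType d) (R : realType) (Sigma : set (set T))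
    (g : {mfun T >-> R}) (nu : probability T R)
    (rho : {measure set T -> \bar R}) (eta : R) :
  Sigma `<=` measurable -> Xg1 Sigma g nu -> (0 <= eta <= 1)%R ->
  rho [set: T] = eta%:E -> (forall A, Sigma A -> rho A = 0) ->
  rho.-integrable [set: T] (EFin \o g) ->
  exists mu : probability T R,
    [/\ Xg1 Sigma g mu,
        forall A, mu A = (1 - eta)%:E * nu A + rho A
      & (\int[mu]_x g x = (1 - eta) * \int[nu]_x g x + \int[rho]_x g x)%R].
Proof.
move=> Sm Xnu /andP[eta0 eta1] rhoT rhoS rhog.
have gnu := Xg1_integrable Sm Xnu.
have k0 : (0 <= 1 - eta)%R by rewrite subr_ge0.
pose k := NngNum k0.
have [||mu muE] := @mixture_ex _ _ _ nu rho k.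
- by rewrite /= lerBlDr lerDl.
- by rewrite /= opprB addrC subrK.
have muE' A : mu A = (1 - eta)%:E * nu A + rho A.
  exact: etrans (congr1 (@^~ A) muE) (measure_addE _ _ _).
have intE u : \int[mu]_x u x = \int[measure_add (mscale k nu) rho]_x u x.
  by apply: eq_measure_integral => A mA _; exact: (congr1 (@^~ A) muE).
have [ki kE] := integral_mscale k gnu.
have mg : measurable_fun [set: T] (fun x => `|(g x)%:E|).
  by apply: measurableT_comp => //; exact/measurable_EFinP.
exists mu; split => //.
- apply/Xg1P => //; split.
    move=> A SA; rewrite muE' rhoS// adde0.
    by have /(Xg1P _ _ Sm)[-> //] := Xnu; rewrite mule0.
  rewrite intE ge0_integral_measure_add//.
  have /integrableP[_ ?] := ki; have /integrableP[_ ?] := rhog.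
  exact: lte_add_pinfty.
- rewrite /Rintegral intE integral_measure_add// kE.
  have nfin := integrable_fin_num measurableT gnu.
  have rfin := integrable_fin_num measurableT rhog.
  by rewrite fineD ?fin_numM// fineM.
Qed.

(** * Essential suprema modulo an ideal *)

Lemma null_ideal_sigma_ideal d (T : measurableType d) (R : realType)
    (Sigma : set (set T)) (g : T -> R) : sigma_ideal (null_ideal Sigma g).
Proof.
split.
- by move=> A [].
- by split=> // mu _; rewrite measure0.
- move=> A B mA AB [mB B0]; split=> // mu Xmu.
  by apply: (subset_measure0 mA mB AB); exact: B0.
- move=> F F0; have mF n : measurable (F n) by have [] := F0 n.
  split; first exact: bigcup_measurable.
  move=> mu Xmu; apply/eqP; rewrite -measure_le0.
  apply: (@le_trans _ _ (\sum_(n <oo) Defs.total_variation mu (F n))).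
    by apply: measure_sigma_subadditive => //; exact: bigcup_measurable.
  by rewrite eseries0// => n _ _; have [_ ->] := F0 n.
Qed.

Section essential_supremum.
Context d (T : measurableType d) (R : realType) (Xi : set (set T)).
Hypothesis Xi_ideal : sigma_ideal Xi.

Lemma sigma_ideal_bigcup (I : countType) (F : I -> set T) :
  (forall i, Xi (F i)) -> Xi (\bigcup_i F i).
Proof.
move=> XiF; have [_ Xi0 _ Xicup] := Xi_ideal.
pose G n := if unpickle n is Some i then F i else set0.
rewrite (_ : \bigcup_i F i = \bigcup_n G n).
  by apply: Xicup => n; rewrite /G; case: unpickle.
apply/seteqP; split=> [x [i _ Fx]|x [n _]].
  by exists (pickle i) => //; rewrite /G pickleK.
by rewrite /G; case: unpickle => // i Fx; exists i.
Qed.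

(** A value of [f] above [M] is outside the essential image, so some interval around it has its
    preimage in [Xi]. Shrinking to rational endpoints leaves countably many intervals. *)
Lemma ideal_ess_sup_null (f : T -> R) (M : R) : measurable_fun [set: T] f ->
  ideal_ess_sup Xi f <= M%:E -> Xi [set x | (M < f x)%R].
Proof.
move=> mf fM; have [_ Xi0 Xisub _] := Xi_ideal.
pose itv_pre (p q : R) : set T := f @^-1` `]p, q[%classic.
have mitv p q : measurable (itv_pre p q).
  by rewrite -[itv_pre p q]setTI; exact: mf.
(* Intervals whose preimage is not in [Xi] are replaced by the empty set, so that the family can be
   indexed by all rational pairs. *)
pose F (pq : rat * rat) := let A := itv_pre (ratr pq.1) (ratr pq.2) in
  if `[< Xi A >] then A else set0.
have XiF pq : Xi (F pq) by rewrite /F; case: asboolP.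
apply: (Xisub _ (\bigcup_pq F pq)); last first.
- exact: sigma_ideal_bigcup.
- move=> x /= Mfx.
  have : ~ ideal_ess_im Xi f (f x).
    move=> fx_im; have : (f x)%:E <= ideal_ess_sup Xi f.
      by apply: ereal_sup_ubound; exists (f x).
    by move=> /le_trans/(_ fM); rewrite lee_fin leNgt Mfx.
  move=> /existsNP[e /not_implyP[/= e0 /contrapT Xie]].
  have [p] := @rat_in_itvoo R (f x - e)%R (f x) ltac:(by rewrite ltrBlDr ltrDl).
  rewrite in_itv/= => /andP[p1 p2].
  have [q] := @rat_in_itvoo R (f x) (f x + e)%R ltac:(by rewrite ltrDl).
  rewrite in_itv/= => /andP[q1 q2].
  exists (p, q) => //; rewrite /F/= asboolT.
    by rewrite /itv_pre/= in_itv/= p2.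
  apply: Xisub Xie => // y /=; rewrite !in_itv/= => /andP[y1 y2].
  by rewrite (lt_trans p1)//= (lt_trans y2).
- rewrite -[X in measurable X]setTI (_ : [set x | _] = f @^-1` `]M, +oo[%classic).
    exact: mf.
  by apply/seteqP; split=> x /=; rewrite in_itv/= andbT.
Qed.

(** If x > t N, the interval of radius x - t N around x lies above t N; its preimage is contained in
    {N < f}, so x is not an essential value. *)
Lemma ideal_ess_supZ_le (f : T -> R) (N t : R) : measurable_fun [set: T] f ->
  (0 <= t)%R -> Xi [set x | (N < f x)%R] ->
  ideal_ess_sup Xi (fun x => t * f x)%R <= (t * N)%:E.
Proof.
move=> mf t0 XiN; have [_ _ Xisub _] := Xi_ideal.
apply: ge_ereal_sup => _ [x xim <-]; rewrite lee_fin leNgt; apply/negP => Nx.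
have e0 : (0 < x - t * N)%R by rewrite subr_gt0.
apply: (xim _ e0); apply: Xisub XiN.
- have mtf : measurable_fun [set: T] (fun x => t * f x)%R.
    by apply: measurable_funM.
  by rewrite -[X in measurable X]setTI; exact: mtf.
- move=> y /=; rewrite in_itv/= => /andP[+ _].
  rewrite opprB addrC subrK => tNf; rewrite ltNge; apply/negP => fN.
  by move: tNf; rewrite ltNge ler_wpM2l.
Qed.

End essential_supremum.

Lemma null_ideal_probability d (T : measurableType d) (R : realType)
    (Sigma : set (set T)) (g : T -> R) (mu : probability T R) (A : set T) :
  Xg1 Sigma g mu -> null_ideal Sigma g A -> mu A = 0.
Proof.
by move=> Xmu [mA] /(_ _ Xmu); rewrite total_variation_finite_measure.
Qed.

(** * The function phi and the conjugate of psi *)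

Section entropy_function.
Context (R : realType) (phi : R -> \bar R).
Hypothesis phi_ge0 : forall x, 0 <= phi x.
Hypothesis phi_convex : econvex phi.
Hypothesis phi_lsc : lower_semicontinuous phi.
Hypothesis phi1 : phi 1%R = 0.
Hypothesis phi_neg : forall x : R, (x < 0)%R -> phi x = +oo.
Hypothesis phi_dom : nbhs (1%R : R) [set x | phi x < +oo].

Lemma econvex_le_itv (a z b : R) : (a <= z <= b)%R -> (a < b)%R ->
  phi z <= ((z - a) / (b - a))%:E * phi b + ((b - z) / (b - a))%:E * phi a.
Proof.
move=> /andP[az zb] ab; have ba0 : (0 < b - a)%R by rewrite subr_gt0.
have t01 : (0 <= (z - a) / (b - a) <= 1)%R.
  by rewrite divr_ge0 ?subr_ge0//= ?ler_pdivrMr ?mul1r ?lerB// ltW.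
have := phi_convex b a t01.
have -> : (1 - (z - a) / (b - a) = (b - z) / (b - a))%R.
  by field; rewrite gt_eqF.
by have -> : ((z - a) / (b - a) * b + (b - z) / (b - a) * a = z)%R;
  first by field; rewrite gt_eqF.
Qed.

(** As [phi] is nonnegative, both convex weights can be raised to 1. *)
Lemma econvex_le_add (a z b : R) : (a <= z <= b)%R -> phi z <= phi a + phi b.
Proof.
move=> /andP[az zb].
have [ab|ba] := ltP a b; last first.
  have -> : z = a by apply/eqP; rewrite eq_le az (le_trans zb).
  by rewrite leeDl.
have ba0 : (0 < b - a)%R by rewrite subr_gt0.
have le1 u v : (0 <= u <= 1)%R -> 0 <= v -> u%:E * v <= v :> \bar R.
  by move=> /andP[u0 u1] v0; rewrite -[leRHS]mul1e lee_wpmul2r.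
apply: le_trans (econvex_le_itv _ ab) _; first by rewrite az.
rewrite addeC leeD// le1// divr_ge0 ?subr_ge0 ?ler_pdivrMr ?mul1r//; lra.
Qed.

(** The chord from (1, 0) to (y, phi y) gives phi x <= (x - 1) / (y - 1) phi y, and (x - 1) / (y -
    1) <= x / y. *)
Lemma ratio_homo (x y : R) : (1 <= x)%R -> (x <= y)%R ->
  phi x * (x^-1)%:E <= phi y * (y^-1)%:E.
Proof.
move=> x1 xy; have x0 : (0 < x)%R by lra.
have [y1|y1] := ltP 1%R y; last first.
  by have -> : x = y by apply/eqP; rewrite eq_le xy; lra.
have := @econvex_le_itv 1%R x y; rewrite x1 xy phi1 mule0 adde0 => /(_ isT y1) H.
rewrite lee_pdivrMr//; apply: le_trans H _.
rewrite -[leRHS]muleA -EFinM [leRHS]muleC lee_wpmul2r// lee_fin.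
rewrite ler_pdivrMr ?subr_gt0// -subr_ge0.
rewrite (_ : _ - _ = 1 - x / y)%R; last by field; rewrite gt_eqF//; lra.
by rewrite subr_ge0 ler_pdivrMr ?mul1r//; lra.
Qed.

(** Constant to the left of 1, which makes the quotient nondecreasing on the whole line without
    changing its limit at +oo. *)
Let ratio (x : R) := phi (Num.max x 1%R) * ((Num.max x 1%R)^-1)%:E.

Let ratio_nd : {homo ratio : x y / (x <= y)%R >-> x <= y}.
Proof.
move=> x y xy; apply: ratio_homo; first by rewrite le_max lexx orbT.
by rewrite ge_max !le_max xy lexx orbT.
Qed.

Lemma slope_pinftyE : slope_pinfty phi = ereal_sup (range ratio).
Proof.
apply/cvg_lim => //; apply: cvg_trans (nondecreasing_cvge ratio_nd).
apply: near_eq_cvg; near=> x; rewrite /ratio max_l//.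
Unshelve. all: by end_near. Qed.

Lemma le_slope_pinfty (x : R) : (1 <= x)%R -> phi x <= slope_pinfty phi * x%:E.
Proof.
move=> x1; rewrite -lee_pdivrMr; last lra.
rewrite slope_pinftyE; apply: ereal_sup_ubound; exists x => //.
by rewrite /ratio max_l.
Qed.

Lemma slope_pinfty_ge0 : 0 <= slope_pinfty phi.
Proof. by have := @le_slope_pinfty 1%R (lexx _); rewrite phi1 mule1. Qed.

Lemma slope_pinfty_oo (A : R) : slope_pinfty phi = +oo ->
  exists2 x0 : R, (1 <= x0)%R & forall x, (x0 <= x)%R -> (A * x)%:E <= phi x.
Proof.
move=> soo; have : A%:E < ereal_sup (range ratio) by rewrite -slope_pinftyE soo ltry.
move=> /ereal_sup_gt[_ [x1 _ <-]] Ax1.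
exists (Num.max x1 1%R); first by rewrite le_max lexx orbT.
move=> x x1x; have x0 : (0 < x)%R by apply: lt_le_trans x1x; rewrite lt_max ltr01 orbT.
rewrite EFinM -lee_pdivlMr//; apply: (le_trans (ltW Ax1)).
by rewrite /ratio ratio_homo// le_max lexx orbT.
Qed.

(** Bound phi y by the chord from a to a far point x, use phi x <= s x, and let x tend to
    infinity. *)
Lemma slope_recession (s a y : R) : slope_pinfty phi = s%:E -> (a <= y)%R ->
  phi y <= phi a + (s * (y - a))%:E.
Proof.
move=> sE ay; have [->|] := eqVneq (phi a) +oo; first by rewrite addye ?leey.
move=> pay; have pafin : phi a \is a fin_num by rewrite ge0_fin_numE// ltey.
have s0 : (0 <= s)%R by rewrite -lee_fin -sE slope_pinfty_ge0.
have [->|ya] := eqVneq y a; first by rewrite subrr mulr0 adde0.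
have {ay ya} ay : (a < y)%R by rewrite lt_neqAle eq_sym ya.
rewrite -(fineK pafin) -EFinD; apply/lee_addgt0Pr => e e0.
(* The error of the chord bound is s (y - a) a / (x - a), at most B / (x - a); [x] is taken so large
   that this is at most [e]. *)
pose B := (s * (y - a) * (`|a| + 1))%R.
pose x := (Num.max y 1 + B / e + `|a| + 1)%R.
have B0 : (0 <= B)%R by rewrite /B !mulr_ge0 ?subr_ge0 ?addr_ge0// ltW.
have Be : (0 <= B / e)%R by rewrite divr_ge0// ltW.
have m1 : (1 <= Num.max y 1)%R by rewrite le_max lexx orbT.
have m2 : (y <= Num.max y 1)%R by rewrite le_max lexx.
have an : (a <= `|a|)%R := ler_norm a.
have a0 : (0 <= `|a|)%R by [].
have yx : (y <= x)%R by rewrite /x; lra.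
have ax : (a < x)%R by lra.
have x1 : (1 <= x)%R by rewrite /x; lra.
have xB : (B / e <= x - a)%R by rewrite /x; lra.
clearbody x.
have := @econvex_le_itv a y x; rewrite yx (ltW ay) => /(_ isT ax)/le_trans; apply.
have := le_slope_pinfty x1; rewrite sE -EFinM => px.
have xa0 : (0 < x - a)%R by rewrite subr_gt0.
apply: (@le_trans _ _ (((y - a) / (x - a))%:E * (s * x)%:E + (fine (phi a))%:E)).
  rewrite leeD//; first by rewrite lee_wpmul2l// lee_fin divr_ge0// subr_ge0 ltW.
  by rewrite fineK// -[leRHS]mul1e lee_wpmul2r// lee_fin ler_pdivrMr// mul1r lerD2l lerN2 ltW.
rewrite -EFinM -!EFinD lee_fin.
suff : (s * (y - a) * (x / (x - a)) <= s * (y - a) + e)%R by lra.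
have -> : (s * (y - a) * (x / (x - a)) = s * (y - a) + s * (y - a) * a / (x - a))%R.
  by field; rewrite gt_eqF.
rewrite lerD2l ler_pdivrMr//; apply: (@le_trans _ _ B).
  by apply: ler_wpM2l; [rewrite mulr_ge0 ?subr_ge0// ltW|lra].
by rewrite mulrC -ler_pdivrMr.
Qed.

(** On the left of 1, [phi] lies below the chord from a point 1 - r0 of its domain to (1, 0). *)
Lemma phi_small (c : R) : (0 < c)%R -> exists2 r : R, (0 < r < 1)%R &
  forall h, (0 <= h <= r)%R -> phi (1 - h)%R <= c%:E.
Proof.
move=> c0; have [e /= e0 eP] := phi_dom.
pose r0 := (Num.min (e / 2) (1 / 2))%R.
have r0gt : (0 < r0)%R by rewrite lt_min !divr_gt0.
have r0e : (r0 <= e / 2)%R by rewrite ge_min lexx.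
have r0h : (r0 <= 1 / 2)%R by rewrite ge_min lexx orbT.
have pr : phi (1 - r0)%R < +oo.
  by apply: eP => /=; rewrite opprB addrC subrK gtr0_norm//; lra.
have prfin : phi (1 - r0)%R \is a fin_num by rewrite ge0_fin_numE.
set p := fine (phi (1 - r0)%R).
have p0 : (0 <= p)%R by rewrite fine_ge0.
(* The chord has height h p / r0 at 1 - h; dividing by p + 1 keeps the radius positive when p =
   0. *)
have q0 : (0 < r0 * c / (p + 1))%R by rewrite divr_gt0 ?mulr_gt0// ltr_wpDl.
exists (Num.min r0 (r0 * c / (p + 1)))%R.
  by rewrite lt_min r0gt q0/= gt_min; apply/orP; left; lra.
move=> h /andP[h0]; rewrite le_min => /andP[hr hc].
have := @econvex_le_itv (1 - r0)%R (1 - h)%R 1%R.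
rewrite phi1 mule0 add0e -(fineK prfin) -/p -EFinM.
have H1 : (1 - r0 <= 1 - h <= 1)%R by lra.
have H2 : (1 - r0 < 1)%R by lra.
move=> /(_ H1 H2)/le_trans; apply; rewrite lee_fin.
have -> : ((1 - (1 - h)) / (1 - (1 - r0)) * p = h * p / r0)%R.
  by field; rewrite !gt_eqF//; lra.
rewrite ler_pdivrMr// mulrC; move: hc; rewrite ler_pdivlMr ?ltr_wpDl//; nra.
Qed.

Let psi (x : R) := phi (x + 1)%R.
Let psis := fenchel_conjugate psi.

Let sub_psi_le (r x : R) : r%:E - psi x <= r%:E.
Proof. by rewrite -[leRHS]adde0 leeD2l// oppe_le0; exact: phi_ge0. Qed.

Lemma conjugate_ge0 y : 0 <= psis y.
Proof.
by apply: ereal_sup_ubound; exists 0%R => //; rewrite /psi mul0r (add0r 1%R) phi1 sube0.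
Qed.

Lemma conjugate_young (x y : R) : ((x - 1) * y)%:E <= phi x + psis y.
Proof.
have := conjugate_ge0 y => c0.
have [->|px] := eqVneq (phi x) +oo; first by rewrite addye ?leey// gt_eqF// (lt_le_trans _ c0).
have pfin : phi x \is a fin_num by rewrite ge0_fin_numE// ltey.
rewrite addeC -leeBlDr//; apply: ereal_sup_ubound; exists (x - 1)%R => //.
by rewrite /psi subrK.
Qed.

(** A supremum of affine functions of [y] is lower semicontinuous; points where [psi] is infinite
    contribute -oo only. *)
Lemma measurable_conjugate : measurable_fun [set: R] psis.
Proof.
apply: lower_semicontinuous_measurable => y a.
move=> /ereal_sup_gt[_ [x _ <-]] ax.
have [px|px] := eqVneq (psi x) +oo; first by move: ax; rewrite px.
have pfin : psi x \is a fin_num by rewrite ge0_fin_numE ?ltey//; exact: phi_ge0.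
move: ax; rewrite -(fineK pfin) -EFinB lte_fin ltrBrDr => ax.
have : (x * z)%R @[z --> y] --> (x * y)%R by exact: mulrl_continuous.
move=> /cvgr_gt/(_ _ ax) nx; eexists; first exact: nx.
move=> z /= xz.
apply: (@lt_le_trans _ _ ((x * z)%:E - psi x)).
  by rewrite -(fineK pfin) -EFinB lte_fin ltrBrDr.
by apply: ereal_sup_ubound; exists x.
Qed.

(** Only x >= -1 counts, since [psi] is infinite below -1, and there x y <= - y. *)
Lemma conjugate_npos y : (y <= 0)%R -> psis y <= `|y|%:E.
Proof.
move=> y0; apply: ge_ereal_sup => _ [x _ <-].
have [x1|x1] := ltP x (-1)%R; first by rewrite /psi phi_neg/= ?leNye//; lra.
apply: (@le_trans _ _ (x * y)%:E); first exact: sub_psi_le.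
rewrite lee_fin ler0_norm//; nra.
Qed.

(** For 0 < y <= M, superlinear growth makes x y - psi x nonpositive once x + 1 >= x0; for smaller x
    it is at most x0 y. So C = x0 works. *)
Lemma conjugate_le_slope_oo (M : R) : slope_pinfty phi = +oo ->
  exists2 C : R, (0 <= C)%R & forall y, (y <= M)%R -> psis y <= (C * `|y|)%:E.
Proof.
move=> soo; have [x0 x01 x0P] := @slope_pinfty_oo `|M|%R soo.
exists x0; first lra.
move=> y yM; have [y0|y0] := leP y 0%R.
  by apply: (le_trans (conjugate_npos y0)); rewrite lee_fin ler_peMl.
rewrite (gtr0_norm y0); apply: ge_ereal_sup => _ [x _ <-].
have [xx0|xx0] := leP x0 (x + 1)%R; last first.
  apply: (@le_trans _ _ (x * y)%:E); first exact: sub_psi_le.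
  by rewrite lee_fin; nra.
apply: (@le_trans _ _ 0); last by rewrite lee_fin; nra.
rewrite sube_le0 /psi; apply: le_trans (x0P _ xx0); rewrite lee_fin.
have := ler_norm M; nra.
Qed.

(* The largest perturbation in [0, n] on which [psi] lies below the line of
   slope y; the suprema over n of y * clip n y dominate [psis y]. *)
Let clip_set (n y : R) := [set x : R | (0 <= x <= n)%R /\ psi x <= (x * y)%:E].
Definition clip (n y : R) : R := sup (clip_set n y).

Let clip_set0 n y : (0 <= n)%R -> clip_set n y 0%R.
Proof. by move=> n0; split; rewrite ?lexx// mul0r /psi add0r phi1. Qed.

Let has_sup_clip n y : (0 <= n)%R -> has_sup (clip_set n y).
Proof.
move=> n0; split; first by exists 0%R; exact: clip_set0.
by exists n => x [/andP[]].
Qed.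

Lemma clip_bounds n y : (0 <= n)%R -> (0 <= clip n y <= n)%R.
Proof.
move=> n0; apply/andP; split.
  by apply: ub_le_sup; [case: (has_sup_clip y n0)|exact: clip_set0].
by apply: ge_sup; [exists 0%R; exact: clip_set0|move=> x [/andP[]]].
Qed.

(** Monotonicity in [y] yields measurability, monotonicity in [n] serves monotone convergence. *)
Lemma clip_homo n m y z : (0 <= n)%R -> (n <= m)%R -> (y <= z)%R ->
  (clip n y <= clip m z)%R.
Proof.
move=> n0 nm yz; apply: le_sup; [|exact: (proj1 (has_sup_clip _ _))|].
  move=> x [/andP[x0 xn] px]; apply/downP; exists x => //; split.
    by rewrite x0 (le_trans xn).
  by apply: (le_trans px); rewrite lee_fin ler_wpM2l.
by apply: has_sup_clip; exact: le_trans nm.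
Qed.

Lemma measurable_clip n : (0 <= n)%R -> measurable_fun [set: R] (clip n).
Proof.
by move=> n0; apply: nondecreasing_measurable => // y z yz; exact: clip_homo.
Qed.

(** The supremum is attained: if the inequality failed, lower semicontinuity would make it fail at
    all points near the supremum, yet some of these belong to [clip_set]. *)
Lemma psi_clip n y : (0 <= n)%R -> psi (clip n y) <= (clip n y * y)%:E.
Proof.
move=> n0; rewrite leNgt; apply/negP => lt.
have [a /andP[a1 a2]] : exists a : R, (clip n y * y < a)%R && (a%:E < psi (clip n y)).
  have [p|p] := eqVneq (psi (clip n y)) +oo.
    by exists (clip n y * y + 1)%R; rewrite p ltry andbT ltrDl.
  have pfin : psi (clip n y) \is a fin_num by rewrite ge0_fin_numE ?ltey//; exact: phi_ge0.
  move: lt; rewrite -(fineK pfin) lte_fin => lt.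
  exists ((clip n y * y + fine (psi (clip n y))) / 2)%R; rewrite lte_fin; lra.
have near1 : \forall x \near clip n y, a%:E < psi x.
  have h : (x + 1)%R @[x --> clip n y] --> (clip n y + 1)%R.
    by apply: cvgD; [exact: cvg_id|exact: cvg_cst].
  have [V nV VP] := phi_lsc a2.
  by near=> x; apply: VP; near: x; exact: h nV.
have near2 : \forall x \near clip n y, (x * y < a)%R.
  have : (x * y)%R @[x --> clip n y] --> (clip n y * y)%R.
    exact: mulrr_continuous.
  by move=> /cvgr_lt/(_ _ a1).
have [e /= e0 eP] := filterI near1 near2.
have [x [xn px] xe] := sup_adherent e0 (has_sup_clip y n0).
have xc : (x <= clip n y)%R by apply: ub_le_sup => //; case: (has_sup_clip y n0).
have [] := eP x.
  by rewrite /= ger0_norm ?subr_ge0// ltrBlDr -ltrBlDl.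
move=> ax xya; have := lt_le_trans ax px; rewrite lte_fin => /(lt_trans xya).
by rewrite ltxx.
Unshelve. all: by end_near. Qed.

(** An x with psi x >= x y contributes at most 0. Any other x is nonnegative and lies in
    [clip_set n y] as soon as n >= x, so that x y <= y * clip n y. *)
Lemma conjugate_le_clip y : (0 <= y)%R ->
  psis y <= ereal_sup (range (fun n : nat => (y * clip n%:R y)%:E)).
Proof.
move=> y0; apply: ge_ereal_sup => _ [x _ <-].
have ub (n : nat) : (y * clip n%:R y)%:E <= ereal_sup (range (fun n : nat => (y * clip n%:R y)%:E)).
  by apply: ereal_sup_ubound; exists n.
have [px|px] := leP (x * y)%:E (psi x).
  apply: le_trans (ub 0%N); apply: (@le_trans _ _ 0); first by rewrite sube_le0.
  by rewrite lee_fin mulr_ge0//; have /andP[] := @clip_bounds 0%R y (lexx _).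
have x0 : (0 <= x)%R.
  have := le_lt_trans (phi_ge0 _) px; rewrite lte_fin; nra.
apply: (@le_trans _ _ (x * y)%:E); first exact: sub_psi_le.
apply: le_trans (ub (Num.trunc x).+1); rewrite lee_fin mulrC ler_wpM2l//.
apply: ub_le_sup; first by case: (has_sup_clip y (ler0n R (Num.trunc x).+1)).
split; last exact: ltW.
by rewrite x0/= ltW// truncnS_gt.
Qed.

End entropy_function.

(** * Mean gap, divergence and cumulant generating function *)

Section gap_and_cumulant.
Context (R : realType) (phi : R -> \bar R).
Hypothesis phi_ge0 : forall x, 0 <= phi x.
Hypothesis phi_convex : econvex phi.
Hypothesis phi_lsc : lower_semicontinuous phi.
Hypothesis phi1 : phi 1%R = 0.
Hypothesis phi_neg : forall x : R, (x < 0)%R -> phi x = +oo.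
Hypothesis phi_dom : nbhs (1%R : R) [set x | phi x < +oo].
Context d (T : measurableType d) (Sigma : set (set T)).
Hypothesis Sigma_measurable : Sigma `<=` measurable.
Implicit Types (mu nu : probability T R) (g : {mfun T >-> R}).

Let psis := fenchel_conjugate (fun x => phi (x + 1)%R).

Let mphi : measurable_fun [set: R] phi.
Proof. exact: lower_semicontinuous_measurable. Qed.

Let mpsis : measurable_fun [set: R] psis.
Proof. exact: measurable_conjugate. Qed.

Let psis_ge0 y : 0 <= psis y.
Proof. exact: conjugate_ge0. Qed.

Let slope_ge0 : 0 <= slope_pinfty phi.
Proof. exact: slope_pinfty_ge0. Qed.

Lemma divergence_ge0 nu mu :
  0 <= divergence phi (charge_of_finite_measure mu) nu.
Proof.
have [N [f [_ _ _ _ ->]]] := divergence_probability nu mu phi_ge0 mphi.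
by rewrite adde_ge0 ?mule_ge0// integral_ge0.
Qed.

(** The shift l cancels between two probability measures, so t times the gap is the difference of
    the integrals of u = t g + l. *)
Lemma gap_le_divergence g nu mu (t l : R) : Xg1 Sigma g nu -> Xg1 Sigma g mu ->
  l%:E + ideal_ess_sup (null_ideal Sigma g) (fun x => t * g x)%R
    <= slope_pinfty phi ->
  (t * (\int[mu]_x g x - \int[nu]_x g x))%:E <=
    divergence phi (charge_of_finite_measure mu) nu +
    \int[nu]_x psis (t * g x + l)%R.
Proof.
move=> Xnu Xmu lS.
have gnu := Xg1_integrable Sigma_measurable Xnu; have gmu := Xg1_integrable Sigma_measurable Xmu.
have [N [f [[mN N0] mf f0 fE DE]]] := divergence_probability nu mu phi_ge0 mphi.
have mg : measurable_fun [set: T] g by exact: measurable_funP.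
pose u x := (t * g x + l)%R.
have mu_ : measurable_fun [set: T] u.
  by apply: measurable_funD => //; exact: measurable_funM.
have [unu unuE] := integral_affine t l gnu.
have [umu umuE] := integral_affine t l gmu.
set Psi := \int[nu]_x _.
have Psi0 : 0 <= Psi by apply: integral_ge0.
have D0 := divergence_ge0 nu mu.
(* If a term on the right is infinite, the claim is trivial; otherwise everything below is
   integrable and integrals can be subtracted. *)
have [->|] := eqVneq (divergence phi (charge_of_finite_measure mu) nu) +oo.
  by rewrite addye ?leey// gt_eqF// (lt_le_trans _ Psi0).
rewrite -ltey => Doo; have [->|] := eqVneq Psi +oo.
  by rewrite addey ?leey// gt_eqF// (lt_le_trans _ D0).
rewrite -ltey => Psioo.
have Phi0 : 0 <= \int[nu]_x phi (f x) by exact: integral_ge0.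
have S0 : 0 <= mu (~` N) * slope_pinfty phi by rewrite mule_ge0.
have Phioo : \int[nu]_x phi (f x) < +oo.
  by apply: le_lt_trans Doo; rewrite DE leeDl.
have Soo : mu (~` N) * slope_pinfty phi < +oo.
  by apply: le_lt_trans Doo; rewrite DE leeDr.
have [urho usigma uE] := integral_mrestr_split mN umu.
pose rho : {finite_measure set T -> \bar R} := mrestr mu mN.
have [fu fuE] := density_integrable (rho := rho) mf f0 fE mu_ urho.
(* The left-hand side is the [nu]-integral of (f - 1) u, to which the Fenchel-Young inequality
   applies pointwise. *)
have ac_le : \int[mrestr mu mN]_x (u x)%:E - \int[nu]_x (u x)%:E <=
    \int[nu]_x phi (f x) + Psi.
  rewrite fuE -integralB//.
  have phii : nu.-integrable [set: T] (fun x => phi (f x)).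
    apply/integrableP; split; first exact: measurableT_comp.
    by under eq_integral do rewrite gee0_abs//.
  have psii : nu.-integrable [set: T] (fun x => psis (u x)).
    apply/integrableP; split; first exact: measurableT_comp.
    by under eq_integral do rewrite gee0_abs//.
  rewrite -integralD//; apply: le_integral => //.
  - exact: integrableB.
  - exact: integrableD.
  - move=> x _; rewrite -EFinB (_ : _ - _ = (f x - 1) * u x)%R; last by ring.
    exact: conjugate_young.
have sing_le : \int[mrestr mu (measurableC mN)]_x (u x)%:E <=
    mu (~` N) * slope_pinfty phi.
  pose sigma : {finite_measure set T -> \bar R} := mrestr mu (measurableC mN).
  have sT : sigma [set: T] = mu (~` N) by rewrite /sigma/= /mrestr setTI.
  have mEu : measurable_fun [set: T] (EFin \o u) by exact/measurable_EFinP.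
  case: (slope_pinfty phi) lS slope_ge0 Soo => [s| |] // lS _ Soo.
  - have u_le : mu [set x | (s - l < t * g x)%R] = 0.
      apply: null_ideal_probability Xmu _; apply: ideal_ess_sup_null.
      + exact: null_ideal_sigma_ideal.
      + exact: measurable_funM.
      + by rewrite EFinB leeBrDl.
    have mA : measurable [set x | (s - l < t * g x)%R].
      have : measurable_fun [set: T] (fun x => t * g x)%R by exact: measurable_funM.
      move=> /(_ measurableT `](s - l)%R, +oo[%classic)/= /(_ (measurable_itv _)).
      rewrite setTI (_ : _ @^-1` _ = [set x | (s - l < t * g x)%R])//.
      by apply/seteqP; split => x /=; rewrite in_itv/= andbT.
    have sA : sigma [set x | (s - l < t * g x)%R] = 0.
      apply: (@subset_measure0 _ _ _ mu _ _ _ mA _ u_le); last exact: subIsetl.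
      by apply: measurableI => //; exact: measurableC.
    (* Truncation at [s] turns the almost everywhere bound u <= s into a pointwise one. *)
    have mmin : measurable_fun [set: T] (fun x => (Num.min (u x) s)%:E).
      by apply/measurable_EFinP; exact: measurable_minr.
    have aeE : ae_eq sigma [set: T] (EFin \o u) (fun x => (Num.min (u x) s)%:E).
      exists [set x | (s - l < t * g x)%R]; split => // x /=.
      rewrite not_implyP => -[_]; apply: contra_notT; rewrite -leNgt => tgs.
      by rewrite min_l// /u -lerBrDr.
    rewrite (ae_eq_integral (fun x => (Num.min (u x) s)%:E))// muleC -sT.
    rewrite -integral_cst//; apply: le_integral => //.
    + have si := finite_measure_integrable_cst sigma `|s|%R measurableT.
      apply: le_integrable (integrableD measurableT (integrable_abse usigma) si) => //.
      move=> x _; rewrite /= lee_fin (ger0_norm (addr_ge0 _ _))//.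
      by rewrite minEle; case: ifP => _; rewrite ?lerDl ?lerDr.
    + exact: finite_measure_integrable_cst.
    + by move=> x _; rewrite lee_fin ge_min lexx orbT.
  (* With infinite slope, finite divergence leaves no singular mass. *)
  - have sig0 : mu (~` N) = 0.
      apply/eqP; apply: contraTT Soo => m0.
      by rewrite gt0_muley ?ltxx// lt_neqAle eq_sym m0/=.
    have sT0 : sigma [set: T] = 0 by rewrite sT.
    by rewrite sig0 mul0e (null_set_integral measurableT mEu sT0).
have nfin : \int[nu]_x (u x)%:E \is a fin_num by rewrite /u unuE.
rewrite DE addeAC; apply: le_trans (leeD ac_le sing_le).
rewrite addeAC -uE unuE umuE -EFinB lee_fin; lra.
Qed.

(** Since f >= 1 - eta almost everywhere, [slope_recession] bounds phi f by phi (1 - eta) + s (f -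
    (1 - eta)). Absolutely continuous and singular excess mass both cost s per unit, and the total
    excess is eta. *)
Lemma divergence_mixture_slope nu mu (eta s : R) : (0 <= eta < 1)%R ->
  slope_pinfty phi = s%:E ->
  (forall A, measurable A -> (1 - eta)%:E * nu A <= mu A) ->
  divergence phi (charge_of_finite_measure mu) nu <=
    phi (1 - eta)%R + (s * eta)%:E.
Proof.
move=> /andP[eta0 eta1] sE mu_ge.
have s0 : (0 <= s)%R by rewrite -lee_fin -sE slope_pinfty_ge0.
have [N [f [[mN N0] mf f0 fE ->]]] := divergence_probability nu mu phi_ge0 mphi.
set a := (1 - eta)%R in mu_ge *.
have a0 : (0 <= a)%R by rewrite /a; lra.
have fi : nu.-integrable [set: T] (EFin \o f).
  apply/integrableP; split; first exact/measurable_EFinP.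
  under eq_integral do rewrite gee0_abs ?lee_fin//.
  by rewrite -fE// setTI ltey_eq fin_num_measure.
have numN A : measurable A -> a%:E * nu A <= \int[nu]_(x in A) (f x)%:E.
  move=> mA; rewrite -fE//; apply: le_trans (mu_ge _ _); last exact: measurableI.
  rewrite lee_wpmul2l// [leRHS](_ : _ = nu A)//.
  have mANC : measurable (A `&` ~` N) by apply: measurableI => //; exact: measurableC.
  have nANC : nu (A `&` ~` N) = 0.
    apply: (@subset_measure0 _ _ _ nu _ _ mANC (measurableC mN) _ N0).
    exact: subIsetr.
  rewrite -[in RHS](setIT A) -(setUv N) setIUr measureU//; last 2 first.
  - exact: measurableI.
  - by rewrite setIACA setICr setI0.
  by rewrite -[LHS]adde0; congr (_ + _); exact/esym.
(* On {f < a} the positive function a - f has nonpositive integral by [numN], so this set is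
   null. *)
have f_ge : {ae nu, forall x, (a <= f x)%R}.
  pose B := [set x | (f x < a)%R].
  have mB : measurable B.
    rewrite -[B]setTI (_ : B = f @^-1` `]-oo, a[%classic); first exact: mf.
    by apply/seteqP; split => x /=; rewrite in_itv.
  have mw : measurable_fun B (fun x => (a - f x)%:E).
    by apply/measurable_EFinP/measurable_funB => //; exact: measurable_funTS.
  have : \int[nu]_(x in B) `|(a - f x)%:E| = 0.
    apply/eqP; rewrite eq_le integral_ge0// andbT.
    under eq_integral.
      move=> x; rewrite inE => fa.
      rewrite gee0_abs; last by rewrite lee_fin subr_ge0 ltW.
      over.
    have fB : nu.-integrable B (EFin \o f) by exact: integrableS fi.
    have aB : nu.-integrable B (cst a%:E) by exact: finite_measure_integrable_cst.
    rewrite (_ : (fun x => _) = (cst a%:E) \- (EFin \o f))//.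
    rewrite integralB// sube_le0 (integral_cst _ mB)//.
    exact: numN.
  move=> /(ae_eq_integral_abs _ mB mw)[Z [mZ Z0 ZP]].
  exists Z; split => // x /= /negP; rewrite -ltNge => fa.
  apply: ZP => /= /(_ fa)[] /eqP; rewrite subr_eq0 => /eqP af.
  by move: fa; rewrite af ltxx.
(* The term s a makes both integrands nonnegative. *)
have main : \int[nu]_x phi (f x) + (s * a)%:E <= phi a + s%:E * mu N.
  have -> : (s * a)%:E = \int[nu]_x (cst (s * a)%:E x).
    by rewrite integral_cst// [X in _ * X](probability_setT nu) mule1.
  have -> : phi a = \int[nu]_x (cst (phi a) x).
    by rewrite integral_cst// [X in _ * X](probability_setT nu) mule1.
  have -> : s%:E * mu N = \int[nu]_x (s * f x)%:E.
    under eq_integral do rewrite EFinM.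
    rewrite ge0_integralZl_EFin//; last 2 first.
    - by move=> x _; rewrite lee_fin.
    - exact/measurable_EFinP.
    by rewrite -fE// setTI.
  have sf0 x : 0 <= (s * f x)%:E by rewrite lee_fin mulr_ge0.
  have msf : measurable_fun [set: T] (fun x => (s * f x)%:E).
    by apply/measurable_EFinP; exact: measurable_funM.
  have mphif : measurable_fun [set: T] (fun x => phi (f x)) by exact: measurableT_comp.
  have sa0 : (0 <= s * a)%R by exact: mulr_ge0.
  rewrite -!ge0_integralD//; last by move=> x _; exact: phi_ge0.
  apply: ae_ge0_le_integral => //.
  - by move=> x _; rewrite adde_ge0.
  - exact: emeasurable_funD.
  - by move=> x _; apply: adde_ge0 => //; exact: phi_ge0.
  - exact: (@emeasurable_funD _ _ _ _ (cst (phi a)) (fun x => (s * f x)%:E)).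
  apply: filterS f_ge => x afx _ /=.
  apply: le_trans (leeD2r _ (slope_recession phi_ge0 phi_convex phi1 sE afx)) _.
  by rewrite -addeA -EFinD leeD2l// lee_fin; lra.
have mu1 : s%:E * mu N + mu (~` N) * s%:E = s%:E.
  rewrite [X in _ + X]muleC -ge0_muleDr// -measureU//; last 2 first.
  - exact: measurableC.
  - by rewrite setICr.
  by rewrite setUv [X in _ * X](probability_setT mu) mule1.
rewrite sE -(leeD2rE _ _ (isT : (s * a)%:E \is a fin_num)).
rewrite addeAC; apply: le_trans (leeD2r _ main) _.
rewrite -addeA mu1 -addeA leeD2l// -EFinD lee_fin /a; lra.
Qed.

(** [mu] has no singular part, and its density 1 - eta + h lies between 1 - eta and 1 + h, where
    [econvex_le_add] applies. *)
Lemma divergence_mixture_density nu mu (eta : R) (h : T -> R) :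
  (0 <= eta < 1)%R -> (forall x, 0 <= h x)%R ->
  nu.-integrable [set: T] (EFin \o h) ->
  (forall A, measurable A ->
    mu A = (1 - eta)%:E * nu A + \int[nu]_(x in A) (h x)%:E) ->
  divergence phi (charge_of_finite_measure mu) nu <=
    phi (1 - eta)%R + \int[nu]_x phi (h x + 1)%R.
Proof.
move=> /andP[eta0 eta1] h0 hi muE.
have [N [f [[mN N0] mf f0 fE ->]]] := divergence_probability nu mu phi_ge0 mphi.
have mh : measurable_fun [set: T] h.
  by apply/measurable_EFinP; exact: measurable_int hi.
have munull A : measurable A -> nu A = 0 -> mu A = 0.
  move=> mA A0; rewrite muE// A0 mule0 add0e null_set_integral//.
  by apply: measurable_funTS; exact/measurable_EFinP.
have mNC : measurable (~` N) by exact: measurableC.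
rewrite (munull _ mNC N0) mul0e adde0.
have fi : nu.-integrable [set: T] (EFin \o f).
  apply/integrableP; split; first exact/measurable_EFinP.
  under eq_integral do rewrite gee0_abs ?lee_fin//.
  by rewrite -fE// setTI ltey_eq fin_num_measure.
have fh : ae_eq nu [set: T] (EFin \o f) (fun x => (1 - eta + h x)%:E).
  apply: integral_ae_eq => //.
    by apply/measurable_EFinP; exact: measurable_funD.
  move=> A _ mA; rewrite -fE//.
  have hA : nu.-integrable A (EFin \o h) by exact: integrableS hi.
  have aA : nu.-integrable A (cst (1 - eta)%:E).
    exact: finite_measure_integrable_cst.
  rewrite (_ : (fun x => _) = (cst (1 - eta)%:E) \+ (EFin \o h))//.
  rewrite integralD// (integral_cst _ mA) -muE//.
  rewrite -[in RHS](setIT A) -(setUv N) setIUr measureU//; last 3 first.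
  - exact: measurableI.
  - exact: measurableI.
  - by rewrite setIACA setICr setI0.
  rewrite -[LHS]adde0; congr (_ + _); apply/esym/munull; first exact: measurableI.
  apply: (@subset_measure0 _ _ _ nu _ _ _ mNC _ N0); first exact: measurableI.
  exact: subIsetr.
have mphih : measurable_fun [set: T] (fun x => phi (h x + 1)%R).
  by apply: measurableT_comp => //; exact: measurable_funD.
have -> : phi (1 - eta)%R = \int[nu]_x (cst (phi (1 - eta)%R) x).
  by rewrite integral_cst// [X in _ * X](probability_setT nu) mule1.
rewrite -ge0_integralD//; last by move=> x _; exact: phi_ge0.
apply: ae_ge0_le_integral => //.
- exact: measurableT_comp.
- by move=> x _; apply: adde_ge0; exact: phi_ge0.
- exact: emeasurable_funD.
apply: filterS fh => x /(_ I)/= [->] _.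
by apply: econvex_le_add => //; have := h0 x; lra.
Qed.

(** * Finiteness of the cumulant generating function and measures of small divergence *)

Lemma cumulant_lty g nu (t l : R) :
  l%:E + ideal_ess_sup (null_ideal Sigma g) (fun x => t * g x)%R
    <= slope_pinfty phi ->
  \int[nu]_x psis (t * g x + l)%R < +oo ->
  cumulant phi g nu (null_ideal Sigma g) t < +oo.
Proof. by move=> lS; apply: le_lt_trans; apply: ereal_inf_lbound; exists l. Qed.

Lemma cumulant_lty_ess_bounded g nu (N t : R) : Xg1 Sigma g nu ->
  null_ideal Sigma g [set x | (N < g x)%R] -> (0 <= t)%R ->
  cumulant phi g nu (null_ideal Sigma g) t < +oo.
Proof.
move=> Xnu gN t0; have mg : measurable_fun [set: T] g by exact: measurable_funP.
have XiN := ideal_ess_supZ_le (null_ideal_sigma_ideal Sigma g) mg t0 gN.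
(* This shift makes t g + l nonpositive outside of the ideal, so the constraint follows from the
   nonnegativity of the slope. *)
apply: (@cumulant_lty _ _ _ (- (t * N))%R).
  apply: le_trans (slope_pinfty_ge0 phi_ge0 phi_convex phi1).
  by apply: le_trans (leeD2l _ XiN) _; rewrite -EFinD lee_fin; lra.
have [ui _] := integral_affine t (- (t * N))%R (Xg1_integrable Sigma_measurable Xnu).
have /integrableP[mu_ uoo] := ui; apply: le_lt_trans uoo.
apply: ae_ge0_le_integral => //.
- by apply: (measurableT_comp mpsis); exact/measurable_EFinP.
- exact: measurableT_comp.
exists [set x | (N < g x)%R]; split.
- by case: gN.
- exact: null_ideal_probability Xnu gN.
- move=> x /=; apply: contra_notT; rewrite -leNgt => gxN _.
  by apply: conjugate_npos => //; have := ler_wpM2l t0 gxN; lra.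
Qed.

(** The mass [eta] is moved to a normalized measure on {g > M} with mean [b] of [g]; this changes
    the mean by eta (b - gnu), so a large [b] needs only a small [eta]. *)
Lemma small_divergence_unbounded g nu (s e c : R) : Xg1 Sigma g nu ->
  slope_pinfty phi = s%:E ->
  (forall N : R, ~ null_ideal Sigma g [set x | (N < g x)%R]) ->
  (0 < e)%R -> (0 < c)%R ->
  exists mu, [/\ Xg1 Sigma g mu,
    (\int[mu]_x g x - \int[nu]_x g x = e)%R
    & divergence phi (charge_of_finite_measure mu) nu < c%:E].
Proof.
move=> Xnu sE gN e0 c0.
have s0 : (0 <= s)%R by rewrite -lee_fin -sE slope_pinfty_ge0.
have c20 : (0 < c / 2)%R by rewrite divr_gt0.
have [r /andP[r0 r1] rP] := phi_small phi_ge0 phi_convex phi1 phi_dom c20.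
set gnu := (\int[nu]_x g x)%R.
(* The first bound keeps phi (1 - eta) below c / 2, the second keeps s eta below c / 4. *)
pose eta0 := (Num.min r (c / (4 * (s + 1))))%R.
have s1 : (0 < s + 1)%R by rewrite ltr_wpDl.
have eta0_gt : (0 < eta0)%R by rewrite lt_min r0 divr_gt0 ?mulr_gt0.
have eta0_r : (eta0 <= r)%R by rewrite ge_min lexx.
have eta0_c : (eta0 * (4 * (s + 1)) <= c)%R.
  by rewrite -ler_pdivlMr ?mulr_gt0// ge_min lexx orbT.
(* A mean b >= M gives b - gnu >= e / eta0, that is, eta <= eta0. *)
pose M := (gnu + e / eta0)%R.
have mg : measurable_fun [set: T] g by exact: measurable_funP.
pose A := [set x | (M < g x)%R].
have mA : measurable A.
  rewrite -[A]setTI (_ : A = g @^-1` `]M, +oo[%classic); first exact: mg.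
  by apply/seteqP; split => x /=; rewrite in_itv/= andbT.
(* The witness is a signed measure, hence the passage to its total variation. *)
have [m [Xm mA0]] : exists m, Xg Sigma g m /\ Defs.total_variation m A <> 0.
  have /not_andP[//|/existsNP[m /not_implyP[Xm mA0]]] := gN M.
  by exists m.
have tfin : Defs.total_variation m A \is a fin_num.
  by rewrite /Defs.total_variation/= fin_num_measure.
pose tau : {measure set T -> \bar R} := mrestr (Defs.total_variation m) mA.
pose a := fine (Defs.total_variation m A).
have tauT : tau [set: T] = a%:E by rewrite /tau/= /mrestr setTI fineK.
have a0 : (0 < a)%R.
  by rewrite fine_gt0// lt0e measure_ge0 andbT -ge0_fin_numE// tfin andbT; exact/eqP.
have [SX goo] := Xm.
have gtv : (Defs.total_variation m).-integrable [set: T] (EFin \o g).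
  by apply/integrableP; split => //; exact/measurable_EFinP.
have [gtau _ _] := integral_mrestr_split mA gtv.
pose G := (\int[tau]_x g x)%R.
have Gfin := integrable_fin_num measurableT gtau.
have GM : (M * a <= G)%R.
  have Mtau : tau.-integrable [set: T] (cst M%:E).
    apply/integrableP; split => //; rewrite (integral_cst _ measurableT `|M|%:E).
    by rewrite tauT -EFinM ltry.
  have tauAC : tau (~` A) = 0 by rewrite /tau/= /mrestr setICl measure0.
  have mAC : measurable (~` A) by exact: measurableC.
  rewrite -lee_fin EFinM -tauT -integral_cst// fineK//.
  rewrite (negligible_integral mAC measurableT Mtau tauAC).
  rewrite (negligible_integral mAC measurableT gtau tauAC).
  apply: le_integral; first exact: measurableD.
  - by apply: integrableS Mtau => //; exact: measurableD.
  - by apply: integrableS gtau => //; exact: measurableD.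
  - by move=> x; rewrite inE => -[_ /contrapT Ax]; rewrite lee_fin ltW.
pose b := (G / a)%R.
have Mb : (M <= b)%R by rewrite ler_pdivlMr.
have eeta0 : (0 < e / eta0)%R by rewrite divr_gt0.
have bgnu : (e / eta0 <= b - gnu)%R by rewrite lerBrDl.
have bgnu0 : (0 < b - gnu)%R by apply: lt_le_trans bgnu.
pose eta := (e / (b - gnu))%R.
have eta_gt0 : (0 < eta)%R by rewrite divr_gt0.
have eta_le : (eta <= eta0)%R.
  by rewrite ler_pdivrMr// mulrC -ler_pdivrMr.
have eta01 : (0 <= eta < 1)%R by rewrite ltW//= (le_lt_trans eta_le)// (le_lt_trans eta0_r).
have k0 : (0 <= eta / a)%R by rewrite divr_ge0// ltW.
pose rho : {measure set T -> \bar R} := mscale (NngNum k0) tau.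
have rhoE B : rho B = (eta / a)%:E * tau B by [].
have rhoT : rho [set: T] = eta%:E.
  by rewrite rhoE tauT -EFinM divfK// gt_eqF.
have rhoS B : Sigma B -> rho B = 0.
  move=> SB; rewrite rhoE /tau/= /mrestr.
  rewrite (@subset_measure0 _ _ _ (Defs.total_variation m) _ B)//; first exact: mule0.
  - by apply: measurableI => //; exact: Sigma_measurable.
  - exact: Sigma_measurable.
  - exact: SX.
have [rhog rhogE] := integral_mscale (NngNum k0) gtau.
have eta01' : (0 <= eta <= 1)%R by case/andP: eta01 => -> /ltW ->.
have [mu [Xmu muE mugE]] := mixture_Xg1 Sigma_measurable Xnu eta01' rhoT rhoS rhog.
exists mu; split => //.
  have rgE : (\int[rho]_x g x = eta * b)%R.
    by rewrite /Rintegral rhogE fineM//= /b /G /Rintegral; ring.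
  by rewrite mugE rgE -/gnu /eta; field; rewrite gt_eqF.
apply: (@le_lt_trans _ _ (phi (1 - eta)%R + (s * eta)%:E)).
  apply: divergence_mixture_slope => // B mB; rewrite muE leeDl//.
have rPe : phi (1 - eta)%R <= (c / 2)%:E.
  by apply: rP; rewrite ltW//= (le_trans eta_le).
apply: (le_lt_trans (leeD2r _ rPe)); rewrite -EFinD lte_fin.
have : (s * eta <= s * eta0)%R by rewrite ler_wpM2l.
nra.
Qed.

(** Scale [h] to k = th h with th = e / H <= 1 and use the density 1 - eta + k, where eta is the
    integral of k. The gap is then the integral of k G, which equals e. *)
Lemma small_divergence_density g nu (e c t : R) (h : T -> R) :
  Xg1 Sigma g nu -> (0 < e)%R ->
  measurable_fun [set: T] h -> (forall x, 0 <= h x)%R ->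
  (exists n : R, forall x, h x <= n)%R ->
  let G x := (g x - \int[nu]_x g x)%R in
  forall r, (0 < r < 1)%R -> (forall s, (0 <= s <= r)%R -> phi (1 - s)%R <= (c / 2)%:E) ->
  (forall x, e / r * h x <= h x * G x)%R ->
  (forall x, phi (h x + 1)%R <= (t * (h x * G x))%:E) ->
  (t * e < c / 2)%R -> (e <= \int[nu]_x (h x * G x))%R ->
  exists mu, [/\ Xg1 Sigma g mu,
    (\int[mu]_x g x - \int[nu]_x g x = e)%R
    & divergence phi (charge_of_finite_measure mu) nu < c%:E].
Proof.
move=> Xnu e0 mh h0 [n hn] G r /andP[r0 r1] rP hM hphi te.
set H := (\int[nu]_x _)%R => eH.
have gi := Xg1_integrable Sigma_measurable Xnu.
have mg : measurable_fun [set: T] g by exact: measurable_funP.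
set gnu := (\int[nu]_x g x)%R in G hM hphi H eH *.
have H0 : (0 < H)%R by exact: lt_le_trans eH.
pose th := (e / H)%R.
have th0 : (0 <= th)%R by rewrite divr_ge0// ltW.
have th1 : (th <= 1)%R by rewrite ler_pdivrMr// mul1r.
have nnu : nu.-integrable [set: T] (cst n%:E) by exact: finite_measure_integrable_cst.
have hi : nu.-integrable [set: T] (EFin \o h).
  apply: le_integrable nnu => //; first exact/measurable_EFinP.
  move=> x _; rewrite /= lee_fin ger0_norm//.
  by apply: le_trans (hn x) _; exact: ler_norm.
have hgi : nu.-integrable [set: T] (fun x => (h x * g x)%:E).
  apply: le_integrable (integrableZl measurableT n gi) => //.
    by apply/measurable_EFinP; exact: measurable_funM.
  move=> x _; rewrite /= lee_fin !normrM ler_wpM2r// ger0_norm//.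
  by apply: le_trans (hn x) _; exact: ler_norm.
pose k x := (th * h x)%R.
have k_ge0 x : (0 <= k x)%R by rewrite mulr_ge0.
have ki : nu.-integrable [set: T] (EFin \o k).
  by have := integrableZl measurableT th hi; apply: eq_integrable.
have mk : measurable_fun [set: T] k by exact: measurable_funM.
have kgi : nu.-integrable [set: T] (fun x => (k x * g x)%:E).
  have := integrableZl measurableT th hgi; apply: eq_integrable => // x _.
  by rewrite -EFinM mulrA.
pose eta := (\int[nu]_x k x)%R.
have etaE : \int[nu]_x (k x)%:E = eta%:E.
  by rewrite /eta /Rintegral fineK//; exact: (integrable_fin_num _ ki).
have kGi : nu.-integrable [set: T] (fun x => (k x * G x)%:E).
  have := integrableB measurableT kgi (integrableZl measurableT gnu ki).
  by apply: eq_integrable => // x _; rewrite /= /G; congr EFin; ring.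
have kGE : (\int[nu]_x (k x * G x) = e)%R.
  have -> : (\int[nu]_x (k x * G x) = \int[nu]_x (th * (h x * G x)))%R.
    by apply: eq_Rintegral => x _; rewrite mulrA.
  rewrite RintegralZl//; first by rewrite -/H /th divfK// gt_eqF.
  have := integrableB measurableT hgi (integrableZl measurableT gnu hi).
  by apply: eq_integrable => // x _; rewrite /= /G; congr EFin; ring.
have kgE : (\int[nu]_x (k x * g x) = e + gnu * eta)%R.
  rewrite -kGE /eta -RintegralZl// -RintegralD//.
    by apply: eq_Rintegral => x _; rewrite /G; ring.
  by have := integrableZl measurableT gnu ki; apply: eq_integrable.
have eta0 : (0 <= eta)%R.
  by rewrite -lee_fin -etaE; apply: integral_ge0 => x _; rewrite lee_fin.
(* Integrating (e / r) k <= k G gives (e / r) eta <= e. *)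
have eta_r : (eta <= r)%R.
  have : (e / r * eta <= e)%R.
    rewrite -[leRHS]kGE /eta -RintegralZl//; apply: le_Rintegral => //.
      by have := integrableZl measurableT (e / r)%R ki; apply: eq_integrable.
    by move=> x _; rewrite /k mulrCA -[leRHS]mulrA ler_wpM2l.
  by rewrite mulrAC ler_pdivrMr// ler_pM2l.
have [rho rhoE] := density_measure_ex k_ge0 ki.
have rhoT : rho [set: T] = eta%:E by rewrite rhoE.
have rhoS A : Sigma A -> rho A = 0.
  move=> SA; have [SX _] := (Xg1P _ _ Sigma_measurable).1 Xnu.
  rewrite rhoE; apply: null_set_integral; [exact: Sigma_measurable| |exact: SX].
  by apply: measurable_funTS; exact/measurable_EFinP.
have densE := density_integral mk k_ge0 (fun A _ => rhoE A).
have rhog : rho.-integrable [set: T] (EFin \o g).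
  apply/integrableP; split; first exact/measurable_EFinP.
  rewrite densE//; last by apply: measurableT_comp => //; exact/measurable_EFinP.
  have /integrableP[_] := kgi; apply: le_lt_trans.
  rewrite le_eqVlt; apply/orP; left; apply/eqP; apply: eq_integral => x _.
  by rewrite /= normrM (ger0_norm (k_ge0 x)) mulrC.
have [_ rhogE] := density_integrable mk k_ge0 (fun A _ => rhoE A) mg rhog.
have eta01 : (0 <= eta <= 1)%R by rewrite eta0/= (le_trans eta_r)// ltW.
have [mu [Xmu muE mugE]] := mixture_Xg1 Sigma_measurable Xnu eta01 rhoT rhoS rhog.
exists mu; split => //.
  rewrite mugE -/gnu {1}/Rintegral rhogE.
  rewrite (_ : fine _ = (e + gnu * eta)%R); first by ring.
  by rewrite -kgE /Rintegral; congr fine; apply: eq_integral => x _; rewrite mulrC.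
apply: (@le_lt_trans _ _ (phi (1 - eta)%R + \int[nu]_x phi (k x + 1)%R)).
  apply: divergence_mixture_density => //; first by rewrite eta0 (le_lt_trans eta_r).
  by move=> A mA; rewrite muE; congr (_ + _); exact: rhoE.
have -> : c%:E = (c / 2)%:E + (c / 2)%:E by rewrite -EFinD; congr EFin; field.
have phi_eta : phi (1 - eta)%R <= (c / 2)%:E by apply: rP; rewrite eta0.
apply: lee_ltD => //.
  by rewrite ge0_fin_numE// (le_lt_trans phi_eta)// ltry.
apply: (@le_lt_trans _ _ (\int[nu]_x (t * (k x * G x))%:E)).
  have tkG x : 0 <= (t * (h x * G x))%:E by apply: le_trans (hphi x).
  apply: ge0_le_integral => //.
  - by apply: measurableT_comp => //; exact: measurable_funD.
  - apply/measurable_EFinP; apply: measurable_funM => //.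
    by apply: measurable_funM => //; exact: measurable_funB.
  (* The point k + 1 is the convex combination of h + 1 and 1 with weight [th], and phi 1 = 0, so
     the bound on phi (h + 1) scales by [th]. *)
  - move=> x _; have := phi_convex (h x + 1)%R 1%R.
    move=> /(_ th); rewrite th0 th1 phi1 mule0 adde0 => /(_ isT).
    rewrite (_ : th * (h x + 1) + (1 - th) * 1 = k x + 1)%R; last by rewrite /k; ring.
    move=> /le_trans; apply.
    rewrite (_ : t * (k x * G x) = th * (t * (h x * G x)))%R; last by rewrite /k; ring.
    by rewrite [leRHS]EFinM lee_wpmul2l.
under eq_integral do rewrite EFinM.
rewrite integralZl//.
have -> : \int[nu]_x (k x * G x)%:E = e%:E.
  by rewrite -kGE /Rintegral fineK//; exact: (integrable_fin_num _ kGi).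
by rewrite -EFinM lte_fin.
Qed.

(** Either some truncated perturbation [h n] has enough gap to be scaled to e, or the uniform bound
    on all these gaps controls the conjugate by monotone convergence. *)
Lemma small_divergence_or_cumulant_lty g nu (e c t : R) : Xg1 Sigma g nu ->
  slope_pinfty phi = +oo -> (0 < e)%R -> (0 < c)%R -> (0 <= t)%R ->
  (t * e < c / 2)%R ->
  (exists mu, [/\ Xg1 Sigma g mu,
    (\int[mu]_x g x - \int[nu]_x g x = e)%R
    & divergence phi (charge_of_finite_measure mu) nu < c%:E]) \/
  cumulant phi g nu (null_ideal Sigma g) t < +oo.
Proof.
move=> Xnu soo e0 c0 t0 te.
have c20 : (0 < c / 2)%R by rewrite divr_gt0.
have [r /andP[r0 r1] rP] := phi_small phi_ge0 phi_convex phi1 phi_dom c20.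
have gi := Xg1_integrable Sigma_measurable Xnu.
have mg : measurable_fun [set: T] g by exact: measurable_funP.
pose gnu := (\int[nu]_x g x)%R.
pose G x := (g x - gnu)%R.
have mG : measurable_fun [set: T] G by exact: measurable_funB.
have mtG : measurable_fun [set: T] (fun x => t * G x)%R by exact: measurable_funM.
(* This is the threshold that keeps the moved mass below [r] in [small_divergence_density]. *)
pose M := (e / r)%R.
have M0 : (0 < M)%R by rewrite divr_gt0.
pose A := [set x | (M < G x)%R].
have mA : measurable A.
  rewrite -[A]setTI (_ : A = G @^-1` `]M, +oo[%classic); first exact: mG.
  by apply/seteqP; split => x /=; rewrite in_itv/= andbT.
pose h (n : nat) x := (\1_A x * clip phi n%:R (t * G x))%R.
have hA n x : A x -> h n x = clip phi n%:R (t * G x).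
  by move=> Ax; rewrite /h indicE mem_set// mul1r.
have hNA n x : ~ A x -> h n x = 0%R.
  by move=> Ax; rewrite /h indicE memNset// mul0r.
have hb n x : (0 <= h n x <= n%:R)%R.
  have [Ax|Ax] := pselect (A x); first by rewrite hA// clip_bounds.
  by rewrite hNA// lexx/=.
have mh n : measurable_fun [set: T] (h n).
  apply: measurable_funM; first exact: measurable_indic.
  by apply: measurableT_comp mtG; exact: measurable_clip.
have hM n x : (M * h n x <= h n x * G x)%R.
  have [Ax|Ax] := pselect (A x); last by rewrite hNA// mulr0 mul0r.
  by rewrite mulrC ler_wpM2l//; [case/andP: (hb n x)|exact: ltW].
have hphi n x : phi (h n x + 1)%R <= (t * (h n x * G x))%:E.
  have [Ax|Ax] := pselect (A x); last by rewrite hNA// mul0r mulr0 add0r phi1.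
  by rewrite hA// mulrCA; apply: psi_clip.
have h_homo x : {homo (fun n => h n x * G x)%R : n m / (n <= m)%N >-> (n <= m)%R}.
  move=> n m nm; have [Ax|Ax] := pselect (A x); last by rewrite !hNA// mul0r.
  rewrite !hA// ler_wpM2r//; first by rewrite ltW// (lt_trans M0).
  by apply: clip_homo => //; rewrite ler_nat.
have [[n en]|noH] := pselect (exists n, (e <= \int[nu]_x (h n x * G x))%R).
  left; apply: (@small_divergence_density _ _ e c t (h n) _ _ _ _ _ r) => //.
  - by move=> x; case/andP: (hb n x).
  - by exists n%:R => x; case/andP: (hb n x).
  - by rewrite r0.
(* This shift centres [g]; with infinite slope every shift is admissible. *)
right; apply: (@cumulant_lty _ _ _ (- (t * gnu))%R).
  by rewrite soo leey.
have [C C0 CP] := conjugate_le_slope_oo phi_ge0 phi_convex phi1 phi_neg (t * M)%R soo.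
have tGE x : (t * g x + - (t * gnu) = t * G x)%R by rewrite /G; ring.
under eq_integral do rewrite tGE.
pose F n x := (t * (h n x * G x))%:E.
have F0 n x : 0 <= F n x by apply: le_trans (hphi n x).
have mF n : measurable_fun [set: T] (F n).
  by apply/measurable_EFinP; apply: measurable_funM => //; exact: measurable_funM.
have ndF x : {homo F^~ x : n m / (n <= m)%N >-> n <= m}.
  by move=> n m nm; rewrite lee_fin ler_wpM2l//; exact: h_homo.
have limF x : limn (F^~ x) = ereal_sup (range (F^~ x)).
  by apply/cvg_lim => //; apply: ereal_nondecreasing_cvgn => n m; exact: ndF.
have Gi : nu.-integrable [set: T] (EFin \o G).
  by have [+ _] := integral_affine 1 (- gnu)%R gi; apply: eq_integrable => // x _;
    rewrite /= mul1r.
have tGi : nu.-integrable [set: T] (fun x => (C * `|t * G x|)%:E).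
  have := integrableZl measurableT C (integrable_abse (integrableZl measurableT t Gi)).
  exact: eq_integrable.
have lim0 x : 0 <= limn (F^~ x).
  by rewrite limF; apply: le_trans (F0 0%N x) _; apply: ereal_sup_ubound; exists 0%N.
have pw x : psis (t * G x)%R <= (C * `|t * G x|)%:E + limn (F^~ x).
  have [GM|MG] := leP (G x) M.
    by apply: le_trans (CP _ _) _; [rewrite ler_wpM2l|rewrite leeDl].
  have G0 : (0 <= G x)%R by rewrite ltW// (lt_trans M0).
  apply: le_trans (conjugate_le_clip phi_ge0 phi1 _) _; first exact: mulr_ge0.
  rewrite limF -[leLHS]add0e leeD// ?lee_fin ?mulr_ge0//.
  apply: ge_ereal_sup => _ [n _ <-]; apply: ereal_sup_ubound; exists n => //.
  by rewrite /F hA//; congr EFin; ring.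
have mlim : measurable_fun [set: T] (fun x => limn (F^~ x)).
  apply: (emeasurable_fun_cvg F) => // x _; rewrite limF.
  by apply: ereal_nondecreasing_cvgn => n m; exact: ndF.
have [mCtG CtGoo] := integrableP _ _ _ tGi.
have CtG0 x : 0 <= (C * `|t * G x|)%:E by rewrite lee_fin mulr_ge0.
apply: (@le_lt_trans _ _ (\int[nu]_x ((C * `|t * G x|)%:E + limn (F^~ x)))).
  apply: ge0_le_integral => //.
  - exact: (measurableT_comp mpsis mtG).
  - exact: emeasurable_funD.
rewrite ge0_integralD//; apply: lte_add_pinfty.
  by apply: le_lt_trans CtGoo; under [leRHS]eq_integral do rewrite gee0_abs//.
rewrite (monotone_convergence nu measurableT mF)//.
apply: (@le_lt_trans _ _ (t * e)%:E); last exact: ltry.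
(* By [noH] every integral of h n * G is below e, so the bound t e survives the limit. *)
apply: lime_le.
  apply: ereal_nondecreasing_is_cvgn => n m nm.
  by apply: ge0_le_integral => // x _; exact: ndF.
apply: nearW => n.
have hGi : nu.-integrable [set: T] (fun x => (h n x * G x)%:E).
  apply: le_integrable (integrableZl measurableT n%:R Gi) => //.
    by apply/measurable_EFinP; exact: measurable_funM.
  move=> x _; have /andP[hn0 hn] := hb n x.
  by rewrite /= lee_fin (normrM (h n x)) (normrM n%:R) ler_wpM2r// normr_nat ger0_norm.
rewrite /F; under eq_integral do rewrite EFinM.
rewrite integralZl// EFinM lee_wpmul2l ?lee_fin//.
rewrite -[leLHS]fineK; last exact: (integrable_fin_num _ hGi).
rewrite lee_fin leNgt; apply/negP => eH; apply: noH; exists n.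
exact: ltW.
Qed.

Lemma cumulant_lty_right g nu (e : R) (c : R) : Xg1 Sigma g nu ->
  (0 < e)%R -> (0 < c)%R ->
  (forall mu, Xg1 Sigma g mu -> (\int[mu]_x g x - \int[nu]_x g x = e)%R ->
    c%:E <= divergence phi (charge_of_finite_measure mu) nu) ->
  forall t : R, (0 <= t)%R -> (t * e < c / 2)%R ->
    cumulant phi g nu (null_ideal Sigma g) t < +oo.
Proof.
move=> Xnu e0 c0 cD t t0 te.
have cD' : ~ exists mu, [/\ Xg1 Sigma g mu,
    (\int[mu]_x g x - \int[nu]_x g x = e)%R
    & divergence phi (charge_of_finite_measure mu) nu < c%:E].
  by move=> [mu [Xmu gap]]; rewrite ltNge cD.
have [[N gN]|gN] := pselect (exists N : R, null_ideal Sigma g [set x | (N < g x)%R]).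
  exact: cumulant_lty_ess_bounded gN t0.
have := slope_pinfty_ge0 phi_ge0 phi_convex phi1.
case sE : (slope_pinfty phi) => [s| |]// _.
- exfalso; apply: cD'; apply: (small_divergence_unbounded Xnu sE) => // N XiN.
  by apply: gN; exists N.
- by have [/cD'|] := small_divergence_or_cumulant_lty Xnu sE e0 c0 t0 te.
Qed.

End gap_and_cumulant.

(** * Reflection of [g], which exchanges t and - t *)

Section mfun_opp.
Context d (T : measurableType d) (R : realType) (Sigma : set (set T)).
Implicit Type g : {mfun T >-> R}.

Lemma Xg_opp g : Xg Sigma (- g)%R = Xg Sigma g.
Proof.
apply/seteqP; split=> m [S0 goo]; split=> //; apply: le_lt_trans goo;
  rewrite le_eqVlt; apply/orP; left; apply/eqP; apply: eq_integral => x _;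
  by rewrite /= normrN.
Qed.

Lemma null_ideal_opp g : null_ideal Sigma (- g)%R = null_ideal Sigma g.
Proof. by rewrite /null_ideal Xg_opp. Qed.

Lemma cumulant_opp (phi : R -> \bar R) g (nu : probability T R) Xi (t : R) :
  cumulant phi (- g)%R nu Xi t = cumulant phi g nu Xi (- t)%R.
Proof.
have gE x : (t * (- g)%R x = - t * g x)%R by rewrite /= mulrN mulNr.
rewrite /cumulant (_ : (fun x => t * (- g)%R x)%R = (fun x => - t * g x)%R).
  congr ereal_inf; apply: eq_imagel => l _; apply: eq_integral => x _.
  by rewrite gE.
exact/funext.
Qed.

End mfun_opp.

(** * Equivalence of nontrivial lower bounds and finiteness of the cumulant generating function near
    0 *)

Theorem corollary5p1p17 (R : realType) (d : measure_display)
    (T : measurableType d)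
    (nontrivial : exists A : set T, [/\ measurable A, A <> set0 & A <> setT])
    (phi : R -> \bar R)
    (phi_ge0 : forall x, 0 <= phi x)
    (phi_convex : econvex phi)
    (phi_lsc : lower_semicontinuous phi)
    (phi1 : phi 1%R = 0)
    (phi_neg : forall x : R, (x < 0)%R -> phi x = +oo)
    (phi_dom : nbhs (1%R : R) [set x | phi x < +oo])
    (Sigma : set (set T)) (Sigma_ideal : sigma_ideal Sigma)
    (g : {mfun T >-> R})
    (nu : probability T R) (Xnu : Xg1 Sigma g nu) :
  let K := cumulant phi g nu (null_ideal Sigma g) in
  [<->
    exists2 e : R, (0 <= e)%R & optimal_lower_bound Sigma g phi nu e <> 0;
    interior [set t : R | K t < +oo] (0%R : R);
    exists L : R -> \bar R,
      [/\ forall e : R, (0 <= e)%R -> 0 <= L e,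
          exists2 e : R, (0 <= e)%R & L e <> 0
        & forall mu : probability T R, Xg1 Sigma g mu ->
            L (mean_gap g mu nu) <=
              divergence phi (charge_of_finite_measure mu) nu];
    exists a b : R, (a < 0 < b)%R /\
      forall t : R, (a < t < b)%R -> K t \is a fin_num].
Proof.
move=> K.
have [Sm _ _ _] := Sigma_ideal.
have D0 := divergence_ge0 phi_ge0 phi_convex phi_lsc phi1 nu.
have K0 t : 0 <= K t.
  apply: le_ereal_inf_tmp => _ [l _ <-]; apply: integral_ge0 => x _.
  exact: conjugate_ge0.
set opt := optimal_lower_bound _ _ _ _.
have opt_ge0 e : 0 <= opt e by apply: le_ereal_inf_tmp => _ [mu _ <-]; exact: D0.
pose P0 := exists2 e : R, (0 <= e)%R & opt e <> 0.
pose P1 := interior [set t : R | K t < +oo] (0%R : R).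
have P01 : P0 -> P1.
  move=> [e e0 /eqP opte].
  have {opte} opte : 0 < opt e by rewrite lt0e opte opt_ge0.
  (* At e = 0 the choice mu = nu makes the infimum vanish; that its divergence is 0 is the mixture
     bound with eta = 0 and h = 0. *)
  have {e0} e0 : (0 < e)%R.
    rewrite lt_neqAle e0 andbT; apply: contraTneq opte => <-.
    rewrite -leNgt; apply: ereal_inf_lbound => /=; exists nu.
      by split; rewrite // /mean_gap subrr normr0.
    apply/eqP; rewrite eq_le D0 andbT.
    have := @divergence_mixture_density _ _ phi_ge0 phi_convex phi_lsc _ _ nu nu 0%R (cst 0%R).
    rewrite lexx ltr01 subr0 phi1 add0e => /(_ isT) H.
    apply: le_trans (H _ _ _) _ => //.
    - by apply: finite_measure_integrable_cst.
    - by move=> A mA; rewrite integral0 adde0 mul1e.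
    - under eq_integral do rewrite /= add0r phi1.
      by rewrite integral0.
  have [c c0 cD] : exists2 c : R, (0 < c)%R & forall mu : probability T R,
      Xg1 Sigma g mu -> mean_gap g mu nu = e ->
      c%:E <= divergence phi (charge_of_finite_measure mu) nu.
    (* The infimum may be +oo; the minimum with 1 yields a real constant. *)
    exists (fine (mine (opt e) 1)).
      rewrite fine_gt0// lt_min opte lte01/=.
      by rewrite gt_min ltry orbT.
    move=> mu Xmu gap; rewrite fineK.
      by rewrite ge_min; apply/orP; left; apply: ereal_inf_lbound; exists mu.
    by rewrite ge0_fin_numE ?gt_min ?ltry ?orbT// le_min ltW//= lee01.
  have Xnu' : Xg1 Sigma (- g)%R nu by rewrite /Xg1/= Xg_opp.
  have gapN mu : Xg1 Sigma (- g)%R mu -> (\int[mu]_x (- g)%R x - \int[nu]_x (- g)%R x = e)%R ->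
      c%:E <= divergence phi (charge_of_finite_measure mu) nu.
    move=> Xmu' gap; have Xmu : Xg1 Sigma g mu by move: Xmu'; rewrite /Xg1/= Xg_opp.
    have intN (m : probability T R) : Xg1 Sigma g m ->
        (\int[m]_x (- g)%R x = - \int[m]_x g x)%R.
      move=> Xm; rewrite -[RHS]mulN1r -RintegralZl//; last exact: Xg1_integrable Xm.
      by apply: eq_Rintegral => x _ /=; rewrite mulN1r.
    apply: cD => //; rewrite /mean_gap -normrN.
    by move: gap; rewrite !intN// opprK opprB addrC => ->; rewrite gtr0_norm.
  have r0 : (0 < c / 2 / e)%R by rewrite !divr_gt0.
  exists (c / 2 / e)%R => // t; rewrite /ball_/= sub0r normrN => tr.
  have te : (`|t| * e < c / 2)%R by rewrite -ltr_pdivlMr.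
  have [t0|t0] := leP 0%R t.
    apply: (cumulant_lty_right phi_ge0 phi_convex phi_lsc phi1 phi_neg phi_dom Sm Xnu e0 c0) => //.
      by move=> mu Xmu gap; apply: cD => //; rewrite /mean_gap gap gtr0_norm.
    by rewrite -(ger0_norm t0).
  have := @cumulant_lty_right _ _ phi_ge0 phi_convex phi_lsc phi1 phi_neg
    phi_dom _ _ _ Sm (- g)%R nu e c Xnu' e0 c0 gapN (- t)%R.
  rewrite cumulant_opp null_ideal_opp opprK; apply; first by rewrite oppr_ge0 ltW.
  by rewrite -(ltr0_norm t0).
have P10 : P1 -> P0.
  move=> [r /= r0 rK].
  have r20 : (0 < r / 2)%R by rewrite divr_gt0.
  have Kfeasible t : (`|t| = r / 2)%R -> exists l k : R,
      [/\ (0 <= k)%R, l%:E + ideal_ess_sup (null_ideal Sigma g) (fun x => t * g x)%R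
        <= slope_pinfty phi
      & \int[nu]_x fenchel_conjugate (fun x => phi (x + 1)%R) (t * g x + l)%R = k%:E].
    move=> tr; have : K t < +oo.
      by apply: rK; rewrite /= sub0r normrN tr ltr_pdivrMr// ltr_pMr// ltr1n.
    move=> /ereal_inf_lt[_ [l lS <-]] koo; set I := integral _ _ _ in koo.
    have I0 : 0 <= I by apply: integral_ge0 => x _; exact: conjugate_ge0.
    exists l, (fine I); split => //; first exact: fine_ge0.
    by rewrite fineK// ge0_fin_numE.
  have [l1 [k1 [k10 lS1 k1E]]] := Kfeasible (r / 2)%R (gtr0_norm r20).
  have [l2 [k2 [k20 lS2 k2E]]] := Kfeasible (- (r / 2))%R (etrans (normrN _) (gtr0_norm r20)).
  (* With this gap r / 2 * e = k1 + k2 + 1, so for either sign of the difference of means the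
     divergence is at least 1. *)
  pose e := ((k1 + k2 + 1) / (r / 2))%R.
  have e0 : (0 <= e)%R by rewrite divr_ge0 ?addr_ge0// ltW.
  exists e => //.
  suff : 1 <= opt e by move=> + opt0; rewrite opt0 lee_fin ler10.
  apply: le_ereal_inf_tmp => _ [mu [Xmu gap] <-].
  have gap_le := gap_le_divergence phi_ge0 phi_convex phi_lsc phi1 Sm Xnu Xmu.
  have := gap_le _ _ lS1; rewrite k1E; have := gap_le _ _ lS2; rewrite k2E.
  have := D0 mu; case: (divergence _ _ _) => [D| |]//; last by move=> *; exact: leey.
  move=> _; rewrite -!EFinD !lee_fin mulNr => H2 H1.
  have eE : (r / 2 * e = k1 + k2 + 1)%R by rewrite /e mulrC divfK// gt_eqF.
  move: gap; rewrite /mean_gap; case: ger0P => _ gap.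
    move: H1; rewrite gap eE; lra.
  by move: H2; rewrite -mulrN gap eE; lra.
have P02 : P0 -> exists L : R -> \bar R,
    [/\ forall e : R, (0 <= e)%R -> 0 <= L e,
        exists2 e : R, (0 <= e)%R & L e <> 0
      & forall mu : probability T R, Xg1 Sigma g mu ->
          L (mean_gap g mu nu) <=
            divergence phi (charge_of_finite_measure mu) nu].
  move=> optP; exists opt; split => // mu Xmu.
  by apply: ereal_inf_lbound; exists mu.
have P20 : (exists L : R -> \bar R,
    [/\ forall e : R, (0 <= e)%R -> 0 <= L e,
        exists2 e : R, (0 <= e)%R & L e <> 0
      & forall mu : probability T R, Xg1 Sigma g mu ->
          L (mean_gap g mu nu) <=
            divergence phi (charge_of_finite_measure mu) nu]) -> P0.
  move=> [L [L0 [e e0 Le] LD]]; exists e => // opt0; apply: Le.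
  apply/eqP; rewrite eq_le L0// andbT -opt0.
  by apply: le_ereal_inf_tmp => _ [mu [Xmu <-] <-]; exact: LD.
(* Each implication of the cycle passes through [P0]; since K is nonnegative, being finite and being
   below +oo coincide. *)
tfae.
- exact: P01.
- by move=> /P10/P02.
- move=> /P20/P01[r /= r0 rK]; exists (- r)%R, r; rewrite oppr_lt0 r0; split => // t tr.
  rewrite ge0_fin_numE//; apply: rK => /=.
  by rewrite sub0r normrN ltr_norml.
- move=> [a [b [/andP[a0 b0] abK]]]; apply: P10.
  have : nbhs (0%R : R) `]a, b[%classic.
    by apply: near_in_itvoo; rewrite in_itv/= a0.
  apply: filterS => t /=; rewrite in_itv/= => /abK.
  by rewrite ge0_fin_numE.
Qed.
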